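(* Let $N$ be a positive integer, let $\alpha=(\alpha_n : n\in\mathbb{Z})$ and $\beta=(\beta_n : n\in\mathbb{Z})$ be real $N$-periodic sequences with $\alpha_n>0$ for all $n$, and let $\tilde a=(\tilde a_k : k\ge 0)$ be a sequence of positive numbers. Assume that $$\prod_{i=1}^{N}\begin{pmatrix}0&1\\-\frac{\alpha_{i-1}}{\alpha_i}&-\frac{\beta_i}{\alpha_i}\end{pmatrix}=\gamma\,\mathrm{Id}\quad\text{for some }|\gamma|=1.$$ Put $$a_{kN+i}=\alpha_i\tilde a_k,\qquad b_{kN+i}=\beta_i\tilde a_k\qquad(i=0,1,\dots,N-1;\ k\ge 0),$$ and let $A$ be the Jacobi operator associated with $(a_n:n\ge0)$ and $(b_n:n\ge0)$. Then: (a) if $\lim_{k\to\infty}\frac{k}{\tilde a_k}=\infty$, then $0\in\sigma_{\mathrm{ess}}(A)$; (b) if the sequence $\left(\frac{k}{\tilde a_k}:k\ge1\right)$ is bounded, then $0\notin\sigma_{\mathrm{ess}}(A)$; (c) if $\lim_{k\to\infty}\frac{k}{\tilde a_k}=0$, then $\sigma_{\mathrm{ess}}(A)=\emptyset$.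
   Context: For matrices, $\prod_{k=n_0}^{n_1}C_k=C_{n_1}C_{n_1-1}\cdots C_{n_0}$. For sequences $a_n>0$, $b_n\in\mathbb{R}$ ($n\ge 0$), let $\mathcal{A}$ be the infinite symmetric tridiagonal matrix with diagonal $b_0,b_1,b_2,\dots$ and off-diagonal entries $a_0,a_1,a_2,\dots$ (so $(\mathcal{A}x)_n=a_{n-1}x_{n-1}+b_nx_n+a_nx_{n+1}$ for $n\ge1$ and $(\mathcal{A}x)_0=b_0x_0+a_0x_1$). The Jacobi operator $A$ on $\ell^2=\ell^2(\mathbb{N})$, $\mathbb{N}=\{0,1,2,\dots\}$, is the restriction of $\mathcal{A}$ to the maximal domain $\mathrm{Dom}(A)=\{x\in\ell^2:\mathcal{A}x\in\ell^2\}$ (under the present assumptions $A$ is self-adjoint). $\sigma_{\mathrm{ess}}(A)$ denotes the essential spectrum of $A$. *)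

(* Defs.v *)
From Stdlib Require Import Reals ZArith.
From Coquelicot Require Import Coquelicot.
Open Scope R_scope.

Definition l2 (x : nat -> C) : Prop := ex_series (fun n => Cmod (x n) ^ 2).

Definition l2norm (x : nat -> C) : R := sqrt (Series (fun n => Cmod (x n) ^ 2)).

(* A possibly unbounded operator in the complex Hilbert space l2.  [act] is a
   total function on sequences; only its values on [dom] are meaningful. *)
Record l2_operator := L2Operator {
  dom : (nat -> C) -> Prop;
  act : (nat -> C) -> nat -> C
}.

(* T - z : dom T -> l2 is bijective with bounded inverse S. *)
Definition in_resolvent_set (T : l2_operator) (z : C) : Prop :=
  exists (S : (nat -> C) -> nat -> C) (M : R),
    (forall y, l2 y ->
       dom T (S y) /\
       (forall n, (act T (S y) n - z * S y n)%C = y n) /\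
       l2norm (S y) <= M * l2norm y) /\
    (forall x, dom T x ->
       l2 (act T x) /\
       forall n, S (fun m => (act T x m - z * x m)%C) n = x n).

Definition in_spectrum (T : l2_operator) (z : C) : Prop :=
  ~ in_resolvent_set T z.

Definition eigenspace (T : l2_operator) (z : C) (x : nat -> C) : Prop :=
  dom T x /\ forall n, act T x n = (z * x n)%C.

Definition is_eigenvalue (T : l2_operator) (z : C) : Prop :=
  exists x, eigenspace T z x /\ exists n, x n <> 0%C.

(* The eigenspace is spanned by v_0, ..., v_d. *)
Definition finite_multiplicity (T : l2_operator) (z : C) : Prop :=
  exists (d : nat) (v : nat -> nat -> C),
    (forall j, (j <= d)%nat -> eigenspace T z (v j)) /\
    forall x, eigenspace T z x ->
      exists c : nat -> C, forall n, x n = sum_n (fun j => (c j * v j n)%C) d.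

Definition isolated_in_spectrum (T : l2_operator) (z : C) : Prop :=
  in_spectrum T z /\
  exists eps : R, 0 < eps /\
    forall w, in_spectrum T w -> Cmod (w - z) < eps -> w = z.

Definition in_discrete_spectrum (T : l2_operator) (z : C) : Prop :=
  isolated_in_spectrum T z /\ is_eigenvalue T z /\ finite_multiplicity T z.

(* The usual definition for a self-adjoint T, whose eigenvalues have equal
   geometric and algebraic multiplicities. *)
Definition in_essential_spectrum (T : l2_operator) (z : C) : Prop :=
  in_spectrum T z /\ ~ in_discrete_spectrum T z.

Definition jacobi_matrix (a b : nat -> R) (x : nat -> C) (n : nat) : C :=
  match n with
  | O => (b 0%nat * x 0%nat + a 0%nat * x 1%nat)%C
  | S m => (a m * x m + b n * x n + a n * x (S n))%C
  end.

(* The maximal operator. *)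
Definition jacobi_operator (a b : nat -> R) : l2_operator :=
  L2Operator (fun x => l2 x /\ l2 (jacobi_matrix a b x)) (jacobi_matrix a b).

Definition mat2 (p q r s : R) : @matrix R 2 2 :=
  mk_matrix 2 2 (fun i j =>
    match i, j with
    | O, O => p
    | O, _ => q
    | _, O => r
    | _, _ => s
    end).

(* M_n M_{n-1} ... M_1, the factor of largest index on the left. *)
Fixpoint mat_prod (M : nat -> @matrix R 2 2) (n : nat) : @matrix R 2 2 :=
  match n with
  | O => Mone
  | S m => Mmult (M n) (mat_prod M m)
  end.

Definition transfer_matrix (alpha beta : Z -> R) (i : Z) : @matrix R 2 2 :=
  mat2 0 1 (- (alpha (i - 1)%Z / alpha i)) (- (beta i / alpha i)).

(* Main.v *)
Require Import Defs.
From Stdlib Require Import Reals ZArith Lra Lia Psatz.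
From Stdlib Require Import Classical IndefiniteDescription FunctionalExtensionality.
From Coquelicot Require Import Coquelicot.
Open Scope R_scope.

(** At energy 0 the modulation decouples from the periodic structure.  Because
    the monodromy matrix is [gamma] times the identity, with [gamma = 1] or
    [gamma = -1], the equation [A x = 0] has two explicit solutions, built block
    by block out of [N]-periodic (up to sign) sequences [u] and [v]:

      [p (k N + i) = gamma^k u_i],   [q (k N + i) = gamma^k v_i / ta_k].

    The solution [p] satisfies the boundary condition at 0, is bounded, has
    modulus 1 at every multiple of [N], and vanishes just before it; [q] is of
    size [1 / ta_k].  Since [p] is not square-summable, 0 is never an eigenvalue,
    so 0 is in the essential spectrum if and only if it is in the spectrum.  The
    inverse of [A] is given by the Green kernel [p_min q_max], up to a constant.

    If [(k + 1) / ta_k <= eps], this kernel is dominated by [eps] times the sum of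
    the averaging operator [y |-> (y_0 + ... + y_n) / (n + 1)] and its adjoint.
    Hardy's inequality therefore gives an inverse of norm [O (eps)]
    ([floquet_solvable]), with a constant depending only on the periodic data.
    This is part (b).  In part (a), a slowly varying cutoff of [p] is an
    approximate null vector: only the increments of the cutoff contribute to
    [A x], each weighted by [ta_k = o(k)], so no bounded inverse can exist
    ([zero_not_in_resolvent_set]).

    For part (c), deleting sufficiently many blocks leaves an operator of the same
    form whose inverse is as small as desired; a Neumann series then inverts
    [A_L - z] for a prescribed [z].  Restoring the deleted rows one at a time
    costs one dimension in total: every [z] is in the resolvent set or is an
    eigenvalue ([solvable_of_tail_solvable]).  Eigenvalues are simple, since an
    eigenvector is determined by its first entry, so it remains to isolate them.
    The normalised eigenvector depends continuously on the eigenvalue, by the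
    estimate [coercive_up_to_first], while eigenvectors to different eigenvalues
    are orthogonal; hence no eigenvalue is a limit of others
    ([eigenvalue_isolated]).  Orthogonality rests on the boundary term in
    Lagrange's identity having lower limit 0, which uses the zeros of [p] and the
    divergence of the harmonic series. *)

(** * Finite sums *)

Lemma sumR_S (f : nat -> R) n : sum_n f (S n) = sum_n f n + f (S n) :> R.
Proof. exact (sum_Sn f n). Qed.

Lemma sumC_S (f : nat -> C) n : sum_n f (S n) = (sum_n f n + f (S n))%C :> C.
Proof. exact (sum_Sn f n). Qed.

Lemma sumR_shift (f : nat -> R) n :
  sum_n f (S n) = f O + sum_n (fun k => f (S k)) n :> R.
Proof.
  induction n as [|n IH].
  - rewrite sumR_S, !sum_O. reflexivity.
  - rewrite sumR_S, IH, (sumR_S (fun k => f (S k))). ring.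
Qed.

Lemma sumR_le (f g : nat -> R) n :
  (forall k, (k <= n)%nat -> f k <= g k) -> sum_n f n <= sum_n g n.
Proof.
  induction n as [|n IH]; intros H.
  - rewrite !sum_O. apply H; lia.
  - rewrite !sumR_S. apply Rplus_le_compat; [apply IH; intros; apply H; lia | apply H; lia].
Qed.

Lemma sumR_const_le (f : nat -> R) c n :
  (forall k, (k <= n)%nat -> f k <= c) -> sum_n f n <= INR (S n) * c.
Proof.
  induction n as [|n IH]; intros H.
  - rewrite sum_O. simpl. rewrite Rmult_1_l. apply H; lia.
  - rewrite sumR_S, S_INR.
    assert (sum_n f n <= INR (S n) * c) by (apply IH; intros; apply H; lia).
    assert (f (S n) <= c) by (apply H; lia). lra.
Qed.

Lemma sumR_ge0 (f : nat -> R) n : (forall k, 0 <= f k) -> 0 <= sum_n f n.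
Proof.
  intros H. induction n as [|n IH].
  - rewrite sum_O. apply H.
  - rewrite sumR_S. specialize (H (S n)). lra.
Qed.

Lemma sumR_mono (f : nat -> R) m n :
  (forall k, 0 <= f k) -> (m <= n)%nat -> sum_n f m <= sum_n f n.
Proof.
  intros H L. induction L as [|n L IH]; [lra|].
  rewrite sumR_S. specialize (H (S n)). lra.
Qed.

Lemma sumR_term_le (f : nat -> R) m n :
  (forall k, 0 <= f k) -> (m <= n)%nat -> f m <= sum_n f n.
Proof.
  intros H L. apply Rle_trans with (sum_n f m); [|apply sumR_mono; assumption].
  destruct m as [|m]; [rewrite sum_O; lra|].
  rewrite sumR_S. assert (0 <= sum_n f m) by (apply sumR_ge0, H). lra.
Qed.

Lemma sumR_plus (f g : nat -> R) n :
  sum_n (fun k => f k + g k) n = sum_n f n + sum_n g n :> R.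
Proof. exact (sum_n_plus f g n). Qed.

Lemma sumR_scal (c : R) (f : nat -> R) n :
  sum_n (fun k => c * f k) n = c * sum_n f n :> R.
Proof. exact (sum_n_mult_l (K := R_Ring) c f n). Qed.

Lemma sumR_multiples (f : nat -> R) N K :
  (0 < N)%nat -> (forall k, 0 <= f k) ->
  sum_n (fun k => f (k * N)%nat) K <= sum_n f (K * N)%nat.
Proof.
  intros HN H. induction K as [|K IH].
  - rewrite sum_O. simpl. rewrite sum_O. lra.
  - rewrite sumR_S.
    replace (S K * N)%nat with (S (K * N + (N - 1))) by (simpl; lia).
    rewrite (sumR_S f).
    assert (sum_n f (K * N)%nat <= sum_n f (K * N + (N - 1))%nat)
      by (apply sumR_mono; [exact H | lia]).
    lra.
Qed.

Lemma Cmod_sum_le (f : nat -> C) n :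
  Cmod (sum_n f n) <= sum_n (fun k => Cmod (f k)) n.
Proof.
  induction n as [|n IH].
  - rewrite !sum_O. lra.
  - rewrite sumC_S, (sumR_S (fun k => Cmod (f k))).
    eapply Rle_trans; [apply Cmod_triangle|]. lra.
Qed.

Lemma sumC_plus (f g : nat -> C) n :
  sum_n (fun k => f k + g k)%C n = (sum_n f n + sum_n g n)%C :> C.
Proof. exact (sum_n_plus f g n). Qed.

Lemma sumC_scal (c : C) (f : nat -> C) n :
  sum_n (fun k => c * f k)%C n = (c * sum_n f n)%C :> C.
Proof. exact (sum_n_mult_l (K := C_Ring) c f n). Qed.

Lemma sumR_cauchy_schwarz (f g : nat -> R) n :
  (sum_n (fun k => f k * g k) n) ^ 2
  <= sum_n (fun k => f k ^ 2) n * sum_n (fun k => g k ^ 2) n.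
Proof.
  induction n as [|n IH].
  - rewrite !sum_O. nra.
  - rewrite !sumR_S.
    set (P := sum_n (fun k => f k * g k) n) in *.
    set (F := sum_n (fun k => f k ^ 2) n) in *.
    set (G := sum_n (fun k => g k ^ 2) n) in *.
    assert (HF : 0 <= F) by (apply sumR_ge0; intros; nra).
    assert (HG : 0 <= G) by (apply sumR_ge0; intros; nra).
    set (s := f (S n)); set (t := g (S n)).
    assert (H : 2 * (P * (s * t)) <= F * t ^ 2 + G * s ^ 2).
    { apply Rsqr_incr_0_var; [unfold Rsqr | nra].
      apply Rle_trans with (4 * (F * G) * (s * t) ^ 2).
      - replace (2 * (P * (s * t)) * (2 * (P * (s * t))))
          with (4 * P ^ 2 * (s * t) ^ 2) by ring.
        apply Rmult_le_compat_r; [apply pow2_ge_0 | nra].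
      - assert (0 <= (F * t ^ 2 - G * s ^ 2) ^ 2) by apply pow2_ge_0. nra. }
    nra.
Qed.

Lemma sumR_cauchy_schwarz_bound (f g : nat -> R) F G n :
  0 <= F -> 0 <= G ->
  sum_n (fun k => f k ^ 2) n <= F ^ 2 -> sum_n (fun k => g k ^ 2) n <= G ^ 2 ->
  sum_n (fun k => f k * g k) n <= F * G.
Proof.
  intros HF HG Hf Hg. apply Rsqr_incr_0_var; [unfold Rsqr | nra].
  assert (H := sumR_cauchy_schwarz f g n).
  assert (0 <= sum_n (fun k => g k ^ 2) n) by (apply sumR_ge0; intros; nra).
  assert (0 <= sum_n (fun k => f k ^ 2) n) by (apply sumR_ge0; intros; nra).
  nra.
Qed.

(** * Square-summable sequences *)

(** Membership in [l2] together with a bound [c] on the norm, phrased by partial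
    sums so that no limit has to be taken to establish or to use it. *)
Definition l2_ball (c : R) (x : nat -> C) : Prop :=
  0 <= c /\ forall M, sum_n (fun n => Cmod (x n) ^ 2) M <= c ^ 2.

Lemma l2_ball_l2 c x : l2_ball c x -> l2 x /\ l2norm x <= c.
Proof.
  intros [Hc H].
  assert (E : ex_series (fun n => Cmod (x n) ^ 2)).
  { destruct (ex_finite_lim_seq_incr (sum_n (fun n => Cmod (x n) ^ 2)) (c ^ 2)) as [l Hl].
    - intros n. rewrite sumR_S. assert (0 <= Cmod (x (S n)) ^ 2) by apply pow2_ge_0. lra.
    - exact H.
    - exists l. exact Hl. }
  split; [exact E|].
  unfold l2norm. rewrite <- (sqrt_pow2 c Hc). apply sqrt_le_1_alt.
  exact (is_lim_seq_le _ _ (Series (fun n => Cmod (x n) ^ 2)) (c ^ 2)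
           H (Series_correct _ E) (is_lim_seq_const (c ^ 2))).
Qed.

Lemma l2norm_ge0 x : 0 <= l2norm x.
Proof. apply sqrt_pos. Qed.

Lemma l2_ball_l2norm x : l2 x -> l2_ball (l2norm x) x.
Proof.
  intros E. split; [apply l2norm_ge0|]. intros M.
  assert (P : forall n, sum_n (fun n => Cmod (x n) ^ 2) n <= Series (fun n => Cmod (x n) ^ 2)).
  { apply is_lim_seq_incr_compare; [exact (Series_correct _ E)|].
    intros n. rewrite sumR_S. assert (0 <= Cmod (x (S n)) ^ 2) by apply pow2_ge_0. lra. }
  unfold l2norm. rewrite pow2_sqrt; [apply P|].
  eapply Rle_trans; [|apply (P O)]. rewrite sum_O. apply pow2_ge_0.
Qed.

Lemma l2_ball_le c d x : c <= d -> l2_ball c x -> l2_ball d x.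
Proof. intros L [Hc H]. split; [lra|]. intros M. specialize (H M). nra. Qed.

Lemma l2_ball_coord c x n : l2_ball c x -> Cmod (x n) <= c.
Proof.
  intros [Hc H]. apply Rsqr_incr_0_var; [unfold Rsqr | exact Hc].
  specialize (H n).
  assert (Cmod (x n) ^ 2 <= sum_n (fun n => Cmod (x n) ^ 2) n).
  { apply (sumR_term_le (fun n => Cmod (x n) ^ 2)); [intros; apply pow2_ge_0 | lia]. }
  lra.
Qed.

Lemma l2_ball_dominated c k x y :
  0 <= k -> l2_ball c y -> (forall n, Cmod (x n) <= k * Cmod (y n)) ->
  l2_ball (k * c) x.
Proof.
  intros Hk [Hc H] D. split; [nra|]. intros M.
  apply Rle_trans with (sum_n (fun n => k ^ 2 * Cmod (y n) ^ 2) M).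
  - apply sumR_le. intros n _. specialize (D n).
    assert (0 <= Cmod (x n)) by apply Cmod_ge_0. nra.
  - rewrite (sumR_scal (k ^ 2) (fun n => Cmod (y n) ^ 2)). specialize (H M).
    rewrite Rpow_mult_distr. apply Rmult_le_compat_l; [apply pow2_ge_0 | exact H].
Qed.

Lemma l2_ball_ext c x y : (forall n, x n = y n) -> l2_ball c x -> l2_ball c y.
Proof.
  intros E H. rewrite <- (Rmult_1_l c). apply l2_ball_dominated with x; [lra | exact H |].
  intros n. rewrite E. lra.
Qed.

Lemma l2_ball_scal c k x : l2_ball c x -> l2_ball (Cmod k * c) (fun n => (k * x n)%C).
Proof.
  intros H. apply l2_ball_dominated with x; [apply Cmod_ge_0 | exact H |].
  intros n. rewrite Cmod_mult. lra.
Qed.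

Lemma l2_ball_plus c d x y :
  l2_ball c x -> l2_ball d y -> l2_ball (c + d) (fun n => (x n + y n)%C).
Proof.
  intros [Hc Hx] [Hd Hy]. split; [lra|]. intros M.
  assert (CS := sumR_cauchy_schwarz_bound (fun n => Cmod (x n)) (fun n => Cmod (y n))
                  c d M Hc Hd (Hx M) (Hy M)).
  simpl in CS. specialize (Hx M). specialize (Hy M).
  apply Rle_trans with
    (sum_n (fun n => Cmod (x n) ^ 2 + (2 * (Cmod (x n) * Cmod (y n)) + Cmod (y n) ^ 2)) M).
  - apply sumR_le. intros n _. assert (T := Cmod_triangle (x n) (y n)).
    assert (0 <= Cmod (x n + y n)%C) by apply Cmod_ge_0. nra.
  - rewrite (sumR_plus (fun n => Cmod (x n) ^ 2)), sumR_plus, sumR_scal. nra.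
Qed.

Lemma l2_ball_tail c x : l2_ball c x -> l2_ball c (fun n => x (S n)).
Proof.
  intros [Hc H]. split; [exact Hc|]. intros M.
  specialize (H (S M)). rewrite sumR_shift in H.
  assert (0 <= Cmod (x O) ^ 2) by apply pow2_ge_0. lra.
Qed.

Lemma l2_ball_cons c x : l2_ball c (fun n => x (S n)) -> l2_ball (Cmod (x O) + c) x.
Proof.
  intros [Hc H]. assert (0 <= Cmod (x O)) by apply Cmod_ge_0.
  split; [lra|]. intros [|M].
  - rewrite sum_O. nra.
  - rewrite sumR_shift. specialize (H M). cbv beta in H. nra.
Qed.

Lemma l2_ball_first c z :
  Cmod z <= c -> l2_ball c (fun n => match n with O => z | S _ => 0%C end).
Proof.
  intros H. assert (0 <= Cmod z) by apply Cmod_ge_0.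
  apply (l2_ball_le (Cmod z + 0)); [lra|].
  apply (l2_ball_cons 0 (fun n => match n with O => z | S _ => 0%C end)).
  split; [lra|]. intros M.
  apply Rle_trans with (INR (S M) * 0); [|lra].
  apply sumR_const_le. intros k _. rewrite Cmod_0. lra.
Qed.

(** Complex limits are only needed coordinatewise, and are reduced to real ones. *)
Definition converges_to (u : nat -> C) (l : C) : Prop :=
  is_lim_seq (fun j => Cmod (u j - l)%C) 0.

Lemma converges_to_Cmod u l : converges_to u l -> is_lim_seq (fun j => Cmod (u j)) (Cmod l).
Proof.
  intros H.
  apply (is_lim_seq_le_le (fun j => Cmod l - Cmod (u j - l)%C) _
                          (fun j => Cmod l + Cmod (u j - l)%C)).
  - intros j.
    assert (T1 := Cmod_triangle (u j - l) l). assert (T2 := Cmod_triangle (u j) (l - u j)).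
    replace (u j - l + l)%C with (u j) in T1 by ring.
    replace (u j + (l - u j))%C with l in T2 by ring.
    replace (l - u j)%C with (- (u j - l))%C in T2 by ring. rewrite Cmod_opp in T2. lra.
  - replace (Finite (Cmod l)) with (Rbar_minus (Cmod l) 0) by (simpl; f_equal; ring).
    apply is_lim_seq_minus'; [apply is_lim_seq_const | exact H].
  - replace (Finite (Cmod l)) with (Rbar_plus (Cmod l) 0) by (simpl; f_equal; ring).
    apply is_lim_seq_plus'; [apply is_lim_seq_const | exact H].
Qed.

(** Closed balls of [l2] are closed under coordinatewise limits (Fatou). *)
Lemma l2_ball_limit c (X : nat -> nat -> C) x :
  0 <= c -> (forall n, converges_to (fun j => X j n) (x n)) ->
  (forall M j, (M <= j)%nat -> sum_n (fun n => Cmod (X j n) ^ 2) M <= c ^ 2) ->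
  l2_ball c x.
Proof.
  intros Hc L H. split; [exact Hc|]. intros M.
  assert (S : is_lim_seq (fun j => sum_n (fun n => Cmod (X j n) ^ 2) M)
                         (sum_n (fun n => Cmod (x n) ^ 2) M)).
  { assert (T : forall n, is_lim_seq (fun j => Cmod (X j n) ^ 2) (Cmod (x n) ^ 2)).
    { intros n. simpl. assert (K := converges_to_Cmod _ _ (L n)).
      apply is_lim_seq_mult'; [exact K|].
      apply is_lim_seq_mult'; [exact K | apply is_lim_seq_const]. }
    clear H. induction M as [|M IH].
    - rewrite sum_O. apply is_lim_seq_ext with (fun j => Cmod (X j O) ^ 2); [|apply T].
      intros j. rewrite sum_O. reflexivity.
    - rewrite sumR_S.
      apply is_lim_seq_ext with
        (fun j => sum_n (fun n => Cmod (X j n) ^ 2) M + Cmod (X j (S M)) ^ 2).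
      { intros j. rewrite sumR_S. reflexivity. }
      apply is_lim_seq_plus'; [exact IH | apply T]. }
  refine (is_lim_seq_le_loc _ _ _ _ _ S (is_lim_seq_const (c ^ 2))).
  exists M. intros j Hj. apply H, Hj.
Qed.

Lemma sumR_abs_bounded_cv (f : nat -> R) B :
  (forall M, sum_n (fun k => Rabs (f k)) M <= B) -> exists l : R, is_lim_seq (sum_n f) l.
Proof.
  intros H.
  assert (E : ex_series (fun k => Rabs (f k))).
  { destruct (ex_finite_lim_seq_incr (sum_n (fun k => Rabs (f k))) B) as [l Hl].
    - intros n. rewrite sumR_S. assert (0 <= Rabs (f (S n))) by apply Rabs_pos. lra.
    - exact H.
    - exists l. exact Hl. }
  destruct (ex_series_Rabs _ E) as [l Hl]. exists l. exact Hl.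
Qed.

Lemma Cmod_le_Re_Im (z : C) : Cmod z <= Rabs (Re z) + Rabs (Im z).
Proof.
  replace z with (RtoC (Re z) + Ci * RtoC (Im z))%C at 1.
  - eapply Rle_trans; [apply Cmod_triangle|].
    rewrite Cmod_mult, !Cmod_R, Cmod_Ci. lra.
  - destruct z as [r i]. unfold Re, Im, Ci, RtoC, Cplus, Cmult. simpl. f_equal; ring.
Qed.

Lemma sumC_abs_bounded_cv (f : nat -> C) B :
  (forall M, sum_n (fun k => Cmod (f k)) M <= B) -> exists l, converges_to (sum_n f) l.
Proof.
  intros H.
  destruct (sumR_abs_bounded_cv (fun k => Re (f k)) B) as [l1 H1].
  { intros M. eapply Rle_trans; [|apply (H M)]. apply sumR_le. intros k _. apply re_le_Cmod. }
  destruct (sumR_abs_bounded_cv (fun k => Im (f k)) B) as [l2 H2].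
  { intros M. eapply Rle_trans; [|apply (H M)]. apply sumR_le. intros k _.
    eapply Rle_trans; [|apply Rmax_Cmod]. apply Rmax_r. }
  assert (HR : forall M, Re (sum_n f M) = sum_n (fun k => Re (f k)) M).
  { induction M as [|M IH]; [rewrite !sum_O; reflexivity|].
    rewrite sumC_S, (sumR_S (fun k => Re (f k))), <- IH. reflexivity. }
  assert (HI : forall M, Im (sum_n f M) = sum_n (fun k => Im (f k)) M).
  { induction M as [|M IH]; [rewrite !sum_O; reflexivity|].
    rewrite sumC_S, (sumR_S (fun k => Im (f k))), <- IH. reflexivity. }
  exists (l1, l2). unfold converges_to.
  apply (is_lim_seq_le_le (fun _ => 0) _
    (fun M => Rabs (sum_n (fun k => Re (f k)) M - l1) + Rabs (sum_n (fun k => Im (f k)) M - l2))).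
  - intros M. split; [apply Cmod_ge_0|].
    rewrite <- HR, <- HI. apply (Cmod_le_Re_Im (sum_n f M - (l1, l2))%C).
  - apply is_lim_seq_const.
  - assert (Z : forall (u : nat -> R) (l : R),
                  is_lim_seq u l -> is_lim_seq (fun M => Rabs (u M - l)) 0).
    { intros u l Hu. apply (proj1 (is_lim_seq_abs_0 (fun M => u M - l))).
      replace (Finite 0) with (Finite (l - l)) by (f_equal; ring).
      apply is_lim_seq_minus'; [exact Hu | apply is_lim_seq_const]. }
    replace (Finite 0) with (Finite (0 + 0)) by (f_equal; ring).
    apply is_lim_seq_plus'; apply Z; assumption.
Qed.

(** * The Hardy inequalities *)

(** Both Hardy inequalities are proved by Elliott's device: the sum of
    [f^2 - 2 f g] telescopes to something nonpositive, and then
    [2 f g <= f^2 / 2 + 2 g^2] absorbs half of the left-hand side. *)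
Lemma sum_sq_le_of_sum_mult_le (f g : nat -> R) M :
  sum_n (fun n => f n ^ 2 - 2 * f n * g n) M <= 0 ->
  sum_n (fun n => f n ^ 2) M <= 4 * sum_n (fun n => g n ^ 2) M.
Proof.
  intros H.
  assert (K : sum_n (fun n => f n ^ 2 + (- 4) * g n ^ 2) M
              <= sum_n (fun n => 2 * (f n ^ 2 - 2 * f n * g n)) M).
  { apply sumR_le. intros n _. assert (0 <= (f n - 2 * g n) ^ 2) by apply pow2_ge_0. nra. }
  rewrite sumR_plus, !sumR_scal in K. lra.
Qed.

Lemma hardy_inequality (y : nat -> R) M :
  sum_n (fun n => (sum_n y n / INR (S n)) ^ 2) M <= 4 * sum_n (fun n => y n ^ 2) M.
Proof.
  set (A := fun n => sum_n y n / INR (S n)).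
  apply (sum_sq_le_of_sum_mult_le A y).
  assert (K : sum_n (fun n => A n ^ 2 - 2 * A n * y n) M + INR (S M) * A M ^ 2 <= 0).
  { induction M as [|M IH].
    - rewrite sum_O. unfold A. rewrite sum_O. simpl INR. right. field.
    - rewrite sumR_S.
      assert (Hy : y (S M) = INR (S (S M)) * A (S M) - INR (S M) * A M).
      { unfold A. rewrite sumR_S. field. split; apply not_0_INR; lia. }
      rewrite Hy. rewrite (S_INR (S M)).
      assert (0 < INR (S M)) by (apply lt_0_INR; lia).
      set (s := A (S M)) in *. set (t := A M) in *. set (w := INR (S M)) in *.
      assert (0 <= w * (s - t) ^ 2) by (apply Rmult_le_pos; [lra | apply pow2_ge_0]).
      nra. }
  assert (0 <= INR (S M) * A M ^ 2) by (apply Rmult_le_pos; [apply pos_INR | apply pow2_ge_0]).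
  lra.
Qed.

(** With [B n] a truncated tail sum of [y m / (m + 1)], this is the inequality for
    the adjoint of the averaging operator.  Prescribing the increments of [B]
    and its vanishing beyond [M] makes the telescoping exact. *)
Lemma dual_hardy_inequality (B y : nat -> R) M :
  (forall n, y n = INR (S n) * (B n - B (S n))) -> B (S M) = 0 ->
  sum_n (fun n => B n ^ 2) M <= 4 * sum_n (fun n => y n ^ 2) M.
Proof.
  intros Hy H0. apply sum_sq_le_of_sum_mult_le.
  assert (K : forall m, sum_n (fun n => B n ^ 2 - 2 * B n * y n) m <= INR (S m) * B (S m) ^ 2).
  { induction m as [|m IH].
    - rewrite sum_O, Hy. simpl INR. assert (0 <= (B O - B 1%nat) ^ 2) by apply pow2_ge_0. nra.
    - rewrite sumR_S, Hy, (S_INR (S m)).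
      set (s := B (S m)) in *. set (t := B (S (S m))) in *. set (w := INR (S m)) in *.
      assert (0 <= (w + 1) * (s - t) ^ 2)
        by (apply Rmult_le_pos; [assert (0 <= w) by apply pos_INR; lra | apply pow2_ge_0]).
      nra. }
  specialize (K M). rewrite H0 in K. lra.
Qed.

(** * Jacobi matrices *)

Lemma jacobi_plus_scal a b (x y : nat -> C) (k : C) n :
  jacobi_matrix a b (fun m => x m + k * y m)%C n
  = (jacobi_matrix a b x n + k * jacobi_matrix a b y n)%C.
Proof. destruct n; simpl; ring. Qed.

(** Summation by parts: symmetry of the Jacobi matrix up to one boundary term. *)
Lemma lagrange_identity a b (x u : nat -> C) n :
  sum_n (fun m => jacobi_matrix a b x m * u m - x m * jacobi_matrix a b u m)%C n
  = (a n * (x (S n) * u n - x n * u (S n)))%C :> C.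
Proof.
  induction n as [|n IH].
  - rewrite sum_O. simpl. ring.
  - rewrite sumC_S, IH. simpl. ring.
Qed.

(** A right inverse of [A - z] of norm at most [c], without linearity: the
    solution may depend arbitrarily on the right-hand side and on its bound. *)
Definition solvable (a b : nat -> R) (z : C) (c : R) : Prop :=
  forall r y, l2_ball r y ->
  exists x, l2_ball (c * r) x /\ forall n, (jacobi_matrix a b x n - z * x n)%C = y n.

(** [p] satisfies the boundary condition at 0; [q] violates it by [kappa], which
    makes [kappa] their (constant) Wronskian. *)
Record zero_energy_pair (a b : nat -> R) (p q : nat -> C) (kappa : R) : Prop := {
  zep_p_first : p O = 1%C;
  zep_p_solves : forall n, jacobi_matrix a b p n = 0%C;
  zep_q_first : q O = 0%C;
  zep_q_source : jacobi_matrix a b q O = (- kappa)%C;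
  zep_q_solves : forall n, jacobi_matrix a b q (S n) = 0%C
}.

(** In Lagrange's identity for [p] and [q] only the first summand is nonzero. *)
Lemma zero_energy_wronskian a b p q kappa :
  zero_energy_pair a b p q kappa ->
  forall n, (a n * (p (S n) * q n - p n * q (S n)))%C = kappa.
Proof.
  intros [p0 Hp q0 Hq0 Hq] n. rewrite <- (lagrange_identity a b p q n).
  induction n as [|n IH].
  - rewrite sum_O, Hp, Hq0, p0. ring.
  - rewrite sumC_S, IH, Hp, Hq. ring.
Qed.

(** The tail sums of [q m * y m], which involve infinitely many entries of [y],
    exist and are square-summable: truncated at [J] they are dominated by the
    truncated tail sums of the dual Hardy inequality, whose value at index 0
    bounds the absolute partial sums. *)
Lemma weighted_tail_bound r E (q y : nat -> C) :
  l2_ball r y -> 0 <= E -> (forall n, Cmod (q n) <= E / INR (S n)) ->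
  exists T, l2_ball (E * (2 * r)) (fun n => T - sum_n (fun m => q m * y m) n)%C.
Proof.
  intros [Hr Hy] HE Hq.
  set (z := fun m => Cmod (y m) / INR (S m)).
  assert (HS : forall n, 0 < INR (S n)) by (intros; apply lt_0_INR; lia).
  assert (Hz : forall m, 0 <= z m).
  { intros m. unfold z. apply Rmult_le_pos; [apply Cmod_ge_0|].
    left. apply Rinv_0_lt_compat, HS. }
  (* The sum of [z m] over [n <= m <= J]; it vanishes at [n = J + 1]. *)
  set (B := fun J n => sum_n z J - sum_n z n + z n).
  assert (HB : forall J M, (M <= J)%nat -> sum_n (fun n => B J n ^ 2) M <= (2 * r) ^ 2).
  { intros J M L.
    apply Rle_trans with (sum_n (fun n => B J n ^ 2) J).
    { apply sumR_mono; [intros; apply pow2_ge_0 | exact L]. }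
    apply Rle_trans with (4 * sum_n (fun n => Cmod (y n) ^ 2) J).
    - apply (dual_hardy_inequality (B J) (fun n => Cmod (y n))).
      + intros n. unfold B. rewrite sumR_S.
        replace (sum_n z J - sum_n z n + z n
                 - (sum_n z J - (sum_n z n + z (S n)) + z (S n))) with (z n) by ring.
        unfold z. field. apply not_0_INR. lia.
      + unfold B. rewrite sumR_S. ring.
    - specialize (Hy J). nra. }
  assert (Hqy : forall m, Cmod (q m * y m)%C <= E * z m).
  { intros m. rewrite Cmod_mult. unfold z.
    replace (E * (Cmod (y m) / INR (S m))) with (E / INR (S m) * Cmod (y m))
      by (unfold Rdiv; ring).
    apply Rmult_le_compat_r; [apply Cmod_ge_0 | apply Hq]. }
  destruct (sumC_abs_bounded_cv (fun m => q m * y m)%C (E * (2 * r))) as [T HT].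
  { intros M. apply Rle_trans with (sum_n (fun m => E * z m) M).
    - apply sumR_le. intros; apply Hqy.
    - rewrite sumR_scal. apply Rmult_le_compat_l; [exact HE|].
      apply Rsqr_incr_0_var; [unfold Rsqr | nra].
      assert (H0 := HB M O ltac:(lia)). rewrite sum_O in H0. unfold B in H0.
      rewrite sum_O in H0.
      assert (Z0 : sum_n z M - z O + z O = sum_n z M) by ring. rewrite Z0 in H0. lra. }
  exists T.
  apply l2_ball_limit with
    (X := fun J n => (sum_n (fun m => q m * y m) J - sum_n (fun m => q m * y m) n)%C).
  - nra.
  - intros n. unfold converges_to in *.
    apply is_lim_seq_ext with (2 := HT). intros J. f_equal. ring.
  - intros M J L.
    apply Rle_trans with (sum_n (fun n => E ^ 2 * B J n ^ 2) M).
    + apply sumR_le. intros n Hn.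
      assert (D : Cmod (sum_n (fun m => q m * y m) J - sum_n (fun m => q m * y m) n)%C
                  <= E * (sum_n z J - sum_n z n)).
      { assert (Hn' : (n <= J)%nat) by lia. clear - Hn' Hqy.
        induction Hn' as [|J L IH].
        - rewrite Rminus_diag, Rmult_0_r.
          replace (_ - _)%C with (RtoC 0) by ring. rewrite Cmod_0. lra.
        - rewrite sumC_S, sumR_S. specialize (Hqy (S J)).
          replace (sum_n (fun m => q m * y m) J + q (S J) * y (S J)
                   - sum_n (fun m => q m * y m) n)%C
            with ((sum_n (fun m => q m * y m) J - sum_n (fun m => q m * y m) n)
                  + q (S J) * y (S J))%C by ring.
          eapply Rle_trans; [apply Cmod_triangle|]. lra. }
      specialize (Hz n).
      assert (0 <= Cmod (sum_n (fun m => q m * y m) J - sum_n (fun m => q m * y m) n)%C)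
        by apply Cmod_ge_0.
      rewrite <- Rpow_mult_distr. apply pow_incr. split; [assumption|].
      unfold B. nra.
    + rewrite (sumR_scal (E ^ 2)). rewrite (Rpow_mult_distr E).
      apply Rmult_le_compat_l; [apply pow2_ge_0 | apply HB, L].
Qed.

(** Variation of parameters: [x] equals [- 1 / kappa] times
    [q_n (sum of p_m y_m for m <= n) + p_n (sum of q_m y_m for m > n)].  The first term is
    controlled by Hardy's inequality and the second by its dual. *)
Lemma green_solvable a b p q kappa C0 E :
  zero_energy_pair a b p q kappa -> 0 < kappa -> 0 <= E ->
  (forall n, Cmod (p n) <= C0) -> (forall n, Cmod (q n) <= E / INR (S n)) ->
  solvable a b 0 (4 * (C0 * E) / kappa).
Proof.
  intros Z Hk HE HpC HqE r y Hy.
  assert (W := zero_energy_wronskian _ _ _ _ _ Z).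
  destruct Z as [p0 Hp q0 Hq0 Hq].
  assert (HC : 0 <= C0) by (eapply Rle_trans; [apply Cmod_ge_0 | apply (HpC O)]).
  destruct (weighted_tail_bound r E q y Hy HE HqE) as [T HR].
  set (P := fun n => sum_n (fun m => p m * y m)%C n : C).
  set (R := fun n => (T - sum_n (fun m => q m * y m) n)%C) in HR.
  assert (PS : forall n, P (S n) = (P n + p (S n) * y (S n))%C) by (intros; apply sumC_S).
  assert (RS : forall n, R (S n) = (R n - q (S n) * y (S n))%C).
  { intros n. unfold R. rewrite sumC_S. ring. }
  exists (fun n => (- / kappa) * (q n * P n + p n * R n))%C. split.
  - assert (HQ : l2_ball (C0 * E * (2 * r)) (fun n => q n * P n)%C).
    { apply l2_ball_dominated with (fun n => RtoC (sum_n (fun m => Cmod (y m)) n / INR (S n))).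
      - nra.
      - destruct Hy as [Hr Hy]. split; [lra|]. intros M.
        apply Rle_trans with (4 * sum_n (fun n => Cmod (y n) ^ 2) M); [|specialize (Hy M); nra].
        eapply Rle_trans; [|apply (hardy_inequality (fun m => Cmod (y m)))].
        right. apply sum_n_ext. intros n. rewrite Cmod_R, RPow_abs, Rabs_pos_eq;
          [reflexivity | apply pow2_ge_0].
      - intros n. rewrite Cmod_mult, Cmod_R.
        assert (0 <= sum_n (fun m => Cmod (y m)) n) by (apply sumR_ge0; intros; apply Cmod_ge_0).
        assert (0 < INR (S n)) by (apply lt_0_INR; lia).
        rewrite Rabs_pos_eq
          by (apply Rmult_le_pos; [assumption | left; apply Rinv_0_lt_compat; assumption]).
        assert (HP : Cmod (P n) <= C0 * sum_n (fun m => Cmod (y m)) n).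
        { unfold P. eapply Rle_trans; [apply Cmod_sum_le|]. rewrite <- sumR_scal.
          apply sumR_le. intros m _. rewrite Cmod_mult.
          apply Rmult_le_compat_r; [apply Cmod_ge_0 | apply HpC]. }
        apply Rle_trans with (E / INR (S n) * (C0 * sum_n (fun m => Cmod (y m)) n)).
        + apply Rmult_le_compat; try apply Cmod_ge_0; [apply HqE | exact HP].
        + right. field. lra. }
    assert (HP : l2_ball (C0 * (E * (2 * r))) (fun n => p n * R n)%C).
    { apply l2_ball_dominated with R; [exact HC | exact HR |].
      intros n. rewrite Cmod_mult. apply Rmult_le_compat_r; [apply Cmod_ge_0 | apply HpC]. }
    assert (H := l2_ball_scal _ (- / kappa)%C _ (l2_ball_plus _ _ _ _ HQ HP)).
    revert H. apply l2_ball_le.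
    assert (Hk' : RtoC kappa <> 0%C) by (intros F; apply RtoC_inj in F; lra).
    rewrite Cmod_opp, Cmod_inv, Cmod_R, Rabs_pos_eq by (try assumption; lra).
    right. field. lra.
  - assert (Hk' : (/ kappa * kappa = 1)%C).
    { apply Cinv_l. intros F; apply RtoC_inj in F; lra. }
    intros [|n].
    + simpl in *. specialize (Hp O). simpl in Hp.
      rewrite (PS O), (RS O). assert (E0 : P O = (p O * y O)%C) by (unfold P; apply sum_O).
      rewrite E0, q0, p0 in *.
      replace (_ - _)%C with
        (- / kappa * (y O * (b O * 0 + a O * q 1%nat) + R O * (b O * 1 + a O * p 1%nat)))%C
        by ring.
      rewrite Hq0, Hp.
      replace (- / kappa * (y O * - kappa + R O * 0))%C with (/ kappa * kappa * y O)%C by ring.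
      rewrite Hk'. ring.
    + specialize (Hp (S n)). specialize (Hq n). specialize (W n).
      simpl in Hp, Hq |- *. rewrite (PS (S n)), (RS (S n)).
      replace (R n) with (R (S n) + q (S n) * y (S n))%C by (rewrite RS; ring).
      replace (P n) with (P (S n) - p (S n) * y (S n))%C by (rewrite PS; ring).
      replace (_ - _)%C with
        (- / kappa * (P (S n) * (a n * q n + b (S n) * q (S n) + a (S n) * q (S (S n)))
                      + R (S n) * (a n * p n + b (S n) * p (S n) + a (S n) * p (S (S n)))
                      - y (S n) * (a n * (p (S n) * q n - p n * q (S n)))))%C
        by ring.
      rewrite Hp, Hq, W.
      transitivity (/ kappa * kappa * y (S n))%C; [ring|]. rewrite Hk'. ring.
Qed.

(** * Perturbation of the energy *)

Lemma converges_to_plus u v l m :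
  converges_to u l -> converges_to v m -> converges_to (fun j => u j + v j)%C (l + m)%C.
Proof.
  intros H K. unfold converges_to.
  apply (is_lim_seq_le_le (fun _ => 0) _ (fun j => Cmod (u j - l)%C + Cmod (v j - m)%C)).
  - intros j. split; [apply Cmod_ge_0|].
    replace (u j + v j - (l + m))%C with ((u j - l) + (v j - m))%C by ring.
    apply Cmod_triangle.
  - apply is_lim_seq_const.
  - replace (Finite 0) with (Finite (0 + 0)) by (f_equal; ring).
    apply is_lim_seq_plus'; assumption.
Qed.

Lemma converges_to_scal k u l :
  converges_to u l -> converges_to (fun j => k * u j)%C (k * l)%C.
Proof.
  intros H. unfold converges_to.
  apply is_lim_seq_ext with (fun j => Cmod k * Cmod (u j - l)%C).
  - intros j. rewrite <- Cmod_mult. f_equal. ring.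
  - replace (Finite 0) with (Rbar_mult (Cmod k) 0) by (simpl; f_equal; ring).
    apply is_lim_seq_scal_l. exact H.
Qed.

Lemma converges_to_unique u l m : converges_to u l -> converges_to u m -> l = m.
Proof.
  intros H K.
  assert (D : converges_to (fun j => u j + (- (1)) * u j)%C (l + (- (1)) * m)%C)
    by (apply converges_to_plus; [exact H | apply converges_to_scal, K]).
  unfold converges_to in D.
  assert (E : is_lim_seq (fun _ : nat => Cmod (l - m)%C) 0).
  { apply is_lim_seq_ext with (2 := D). intros j.
    replace (u j + - (1) * u j - (l + - (1) * m))%C with (- (l - m))%C by ring.
    apply Cmod_opp. }
  assert (F := is_lim_seq_unique _ _ E). rewrite Lim_seq_const in F. injection F as F.
  apply Cmod_eq_0 in F. apply Ceq_minus. exact F.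
Qed.

Lemma converges_to_jacobi a b z (X : nat -> nat -> C) x :
  (forall n, converges_to (fun j => X j n) (x n)) ->
  forall n, converges_to (fun j => jacobi_matrix a b (X j) n - z * X j n)%C
                         (jacobi_matrix a b x n - z * x n)%C.
Proof.
  intros H n.
  assert (K : converges_to (fun j => jacobi_matrix a b (X j) n) (jacobi_matrix a b x n)).
  { destruct n as [|n]; simpl; repeat apply converges_to_plus; apply converges_to_scal, H. }
  assert (L := converges_to_plus _ _ _ _ K (converges_to_scal (- z)%C _ _ (H n))).
  unfold converges_to in *. apply is_lim_seq_ext with (2 := L). intros j. f_equal. ring.
Qed.

(** Neumann series, run as an iteration on residuals: solving [A x_j = res_j]
    leaves for [A - z] the residual [z x_j], of at most half the size. *)
Lemma solvable_perturb a b z c :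
  0 <= c -> c * Cmod z <= / 2 -> solvable a b 0 c -> solvable a b z (2 * c).
Proof.
  intros Hc Hz Hs r y Hy.
  destruct (functional_choice (fun (ry : R * (nat -> C)) x =>
      l2_ball (fst ry) (snd ry) ->
      l2_ball (c * fst ry) x /\
      forall n, (jacobi_matrix a b x n - 0 * x n)%C = snd ry n)) as [G HG].
  { intros [r' y']. simpl. destruct (classic (l2_ball r' y')) as [B|B].
    - destruct (Hs r' y' B) as [x Hx]. exists x. intros _. exact Hx.
    - exists y'. intros B'. contradiction. }
  assert (Hr : 0 <= r) by apply Hy.
  set (rho := fun j => r * (/ 2) ^ j).
  assert (Hrho : forall j, 0 <= rho j).
  { intros j. apply Rmult_le_pos; [exact Hr | apply pow_le; lra]. }
  (* The residual left after the first j correction steps. *)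
  set (res := fix res j := match j with
                           | O => y
                           | S i => fun n => (z * G (rho i, res i) n)%C
                           end).
  set (x := fun j => G (rho j, res j)).
  assert (Hres : forall j, l2_ball (rho j) (res j)).
  { induction j as [|j IH].
    - unfold rho. simpl. rewrite Rmult_1_r. exact Hy.
    - destruct (HG (rho j, res j) IH) as [B _]. simpl in B.
      apply (l2_ball_le (Cmod z * (c * rho j))); [|apply (l2_ball_scal _ z _ B)].
      unfold rho. simpl. fold (rho j).
      replace (r * (/ 2 * (/ 2) ^ j)) with (/ 2 * rho j) by (unfold rho; ring).
      specialize (Hrho j). nra. }
  assert (Hx : forall j, l2_ball (c * rho j) (x j)) by (intros j; apply (HG (rho j, res j)), Hres).
  assert (Ax : forall j n, jacobi_matrix a b (x j) n = res j n).
  { intros j n. destruct (HG (rho j, res j) (Hres j)) as [_ E]. specialize (E n).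
    simpl in E. fold (x j) in E. rewrite <- E. ring. }
  set (X := fun j n => sum_n (fun i => x i n) j : C).
  assert (XS : forall j n, X (S j) n = (X j n + x (S j) n)%C)
    by (intros; apply sumC_S).
  assert (HX : forall j, l2_ball (c * (2 * r - rho j)) (X j)).
  { induction j as [|j IH].
    - apply l2_ball_ext with (x O); [intros n; unfold X; rewrite sum_O; reflexivity|].
      apply (l2_ball_le (c * rho O)); [|apply Hx]. unfold rho. simpl. right. ring.
    - apply l2_ball_ext with (fun n => X j n + x (S j) n)%C;
        [intros n; rewrite XS; reflexivity|].
      apply (l2_ball_le (c * (2 * r - rho j) + c * rho (S j)));
        [|apply l2_ball_plus; [exact IH | apply Hx]].
      unfold rho. simpl. right. field. }
  assert (HL : exists l, forall n, converges_to (fun j => X j n) (l n)).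
  { apply (functional_choice (fun n l => converges_to (fun j => X j n) l)).
    intros n. apply (sumC_abs_bounded_cv (fun i => x i n) (c * (2 * r))).
    intros M. apply Rle_trans with (c * (2 * r - rho M)).
    - apply Rle_trans with (sum_n (fun i => c * rho i) M).
      + apply sumR_le. intros i _. apply (l2_ball_coord _ (x i)), Hx.
      + rewrite sumR_scal. right. f_equal. induction M as [|M IH].
        * rewrite sum_O. unfold rho. simpl. ring.
        * rewrite sumR_S, IH. unfold rho. simpl. field.
    - specialize (Hrho M). nra. }
  destruct HL as [l HL]. exists l. split.
  - apply l2_ball_limit with X; [nra | exact HL |].
    intros M j _. destruct (HX j) as [H0 HM].
    eapply Rle_trans; [apply HM|]. apply pow_incr. split; [exact H0|].
    specialize (Hrho j). nra.
  - intros n. apply (converges_to_unique (fun j => jacobi_matrix a b (X j) n - z * X j n)%C).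
    + apply converges_to_jacobi, HL.
    + assert (E : forall j, (jacobi_matrix a b (X j) n - z * X j n
                             = y n - res (S j) n)%C).
      { induction j as [|j IH].
        - assert (EX : X O = x O).
          { apply functional_extensionality. intros m. unfold X. rewrite sum_O. reflexivity. }
          rewrite EX, Ax. reflexivity.
        - assert (EX : X (S j) = fun m => (X j m + 1 * x (S j) m)%C).
          { apply functional_extensionality. intros m. rewrite XS. ring. }
          rewrite EX, jacobi_plus_scal, Ax.
          change (res (S (S j)) n) with (z * x (S j) n)%C.
          replace (res (S j) n)
            with (y n - (jacobi_matrix a b (X j) n - z * X j n))%C by (rewrite IH; ring).
          ring. }
      unfold converges_to.
      apply (is_lim_seq_le_le (fun _ => 0) _ (fun j => rho (S j))).
      * intros j. split; [apply Cmod_ge_0|]. rewrite E.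
        replace (y n - res (S j) n - y n)%C with (- res (S j) n)%C by ring.
        rewrite Cmod_opp. apply (l2_ball_coord _ (res (S j))), Hres.
      * apply is_lim_seq_const.
      * apply (is_lim_seq_incr_1 rho). unfold rho.
        replace (Finite 0) with (Rbar_mult r 0) by (simpl; f_equal; ring).
        apply is_lim_seq_scal_l. apply is_lim_seq_geom. rewrite Rabs_pos_eq; lra.
Qed.

(** The a-priori estimate dual to [solvable]: it bounds every solution in [l2],
    but does not provide any. *)
Definition coercive (a b : nat -> R) (z : C) (c : R) : Prop :=
  forall r y x, l2 x -> l2_ball r y ->
  (forall n, (jacobi_matrix a b x n - z * x n)%C = y n) -> l2_ball (c * r) x.

Definition injective_on_l2 (a b : nat -> R) (z : C) : Prop :=
  forall x, l2 x -> (forall n, jacobi_matrix a b x n = (z * x n)%C) -> forall n, x n = 0%C.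

Lemma solution_unique a b z x x' :
  injective_on_l2 a b z -> l2 x -> l2 x' ->
  (forall n, (jacobi_matrix a b x n - z * x n = jacobi_matrix a b x' n - z * x' n)%C) ->
  forall n, x n = x' n.
Proof.
  intros I Hx Hx' E n. apply Ceq_minus.
  replace (x n - x' n)%C with (x n + (- (1)) * x' n)%C by ring.
  apply (I (fun n => x n + (- (1)) * x' n)%C).
  - apply l2_ball_l2 with (l2norm x + Cmod (- (1))%C * l2norm x').
    apply l2_ball_plus; [|apply l2_ball_scal]; apply l2_ball_l2norm; assumption.
  - intros m. rewrite jacobi_plus_scal. specialize (E m).
    apply Ceq_minus in E. apply Ceq_minus. rewrite <- E. ring.
Qed.

Lemma coercive_of_solvable a b z c :
  injective_on_l2 a b z -> solvable a b z c -> coercive a b z c.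
Proof.
  intros I Hs r y x Hx Hy E. destruct (Hs r y Hy) as [x' [B E']].
  apply l2_ball_ext with x'; [|exact B].
  apply (solution_unique a b z); [exact I | apply (l2_ball_l2 _ _ B) | exact Hx |].
  intros n. rewrite E, E'. reflexivity.
Qed.

Lemma coercive_perturb a b z c :
  0 <= c -> c * Cmod z <= / 2 -> coercive a b 0 c -> coercive a b z (2 * c).
Proof.
  intros Hc Hz K r y x Hx Hy E.
  assert (Bx := l2_ball_l2norm x Hx).
  assert (B : l2_ball (c * (r + Cmod z * l2norm x)) x).
  { apply (K _ (fun n => y n + z * x n)%C); [exact Hx | |].
    - apply l2_ball_plus; [exact Hy | apply l2_ball_scal, Bx].
    - intros n. rewrite <- E. ring. }
  apply l2_ball_le with (2 := Bx).
  assert (N := proj2 (l2_ball_l2 _ _ B)). assert (P := l2norm_ge0 x). nra.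
Qed.

(** * Removing finitely many rows *)

(** Dropping row 0 loses one equation and no unknown.  In this form solvability
    passes from the matrix without its first row and column to the full one,
    whether or not [z] is an eigenvalue of either. *)
Definition tail_solvable (a b : nat -> R) (z : C) : Prop :=
  exists c, 0 <= c /\ forall r y, l2_ball r y ->
  exists x, l2_ball (c * r) x /\
    forall n, (jacobi_matrix a b x (S n) - z * x (S n))%C = y (S n).

(** A square-summable solution that need not satisfy the boundary condition; it
    spans the freedom left by dropping row 0. *)
Definition has_weyl_solution (a b : nat -> R) (z : C) : Prop :=
  exists f, l2 f /\ (exists n, f n <> 0%C) /\
    forall n, jacobi_matrix a b f (S n) = (z * f (S n))%C.

(** Coercivity may fail at an eigenvalue, but only through the first entry, which
    determines the eigenvector. *)
Definition coercive_up_to_first (a b : nat -> R) (z : C) : Prop :=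
  exists c, 0 <= c /\ forall r y x, l2 x -> l2_ball r y ->
  (forall n, (jacobi_matrix a b x n - z * x n)%C = y n) ->
  l2_ball (c * (Cmod (x O) + r)) x.

Lemma RtoC_pos_neq0 r : 0 < r -> RtoC r <> 0%C.
Proof. intros H F. apply RtoC_inj in F. lra. Qed.

(** Extends a sequence by one entry to the left, chosen so that row 1 of [A - z]
    takes the value [s]. *)
Definition prolong (a b : nat -> R) (z : C) (s : C) (x : nat -> C) (n : nat) : C :=
  match n with
  | O => ((s - (b 1%nat - z) * x O - a 1%nat * x 1%nat) / a O)%C
  | S m => x m
  end.

Lemma prolong_row a b z s x :
  0 < a O ->
  (jacobi_matrix a b (prolong a b z s x) 1 - z * prolong a b z s x 1)%C = s.
Proof. intros H. simpl. field. apply RtoC_pos_neq0, H. Qed.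

Lemma prolong_rows a b z s x n :
  jacobi_matrix a b (prolong a b z s x) (S (S n))
  = jacobi_matrix (fun n => a (S n)) (fun n => b (S n)) x (S n).
Proof. reflexivity. Qed.

Lemma tail_solvable_peel a b z :
  (forall n, 0 < a n) ->
  tail_solvable (fun n => a (S n)) (fun n => b (S n)) z -> tail_solvable a b z.
Proof.
  intros Ha [c [Hc Hs]].
  assert (Ha0 := Ha O). assert (Ha1 := Ha 1%nat).
  assert (Hbz := Cmod_ge_0 (b 1%nat - z)%C).
  set (c0 := (1 + Cmod (b 1%nat - z)%C * c + a 1%nat * c) / a O).
  assert (Hc0 : 0 <= c0) by (apply Rmult_le_pos; [nra | left; apply Rinv_0_lt_compat, Ha0]).
  exists (c0 + c). split; [lra|]. intros r y Hy.
  destruct (Hs r (fun n => y (S n)) (l2_ball_tail _ _ Hy)) as [x [Bx Ex]].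
  exists (prolong a b z (y 1%nat) x). split.
  - assert (Hr : 0 <= r) by apply Hy.
    apply (l2_ball_le (Cmod (prolong a b z (y 1%nat) x O) + c * r)).
    + rewrite Rmult_plus_distr_r. apply Rplus_le_compat_r. unfold prolong, c0.
      rewrite Cmod_div, Cmod_R, Rabs_pos_eq by (try apply RtoC_pos_neq0; lra).
      unfold Rdiv. rewrite (Rmult_comm _ r), <- Rmult_assoc.
      apply Rmult_le_compat_r; [left; apply Rinv_0_lt_compat, Ha0|].
      assert (B0 := l2_ball_coord _ _ 0 Bx). assert (B1 := l2_ball_coord _ _ 1 Bx).
      assert (By := l2_ball_coord _ _ 1 Hy).
      assert (T1 := Cmod_triangle (y 1%nat - (b 1%nat - z) * x O)%C (- (a 1%nat * x 1%nat))%C).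
      assert (T2 := Cmod_triangle (y 1%nat) (- ((b 1%nat - z) * x O))%C).
      rewrite Cmod_opp, Cmod_mult in T1, T2. rewrite Cmod_R, Rabs_pos_eq in T1 by lra.
      unfold Cminus in *. nra.
    + apply (l2_ball_cons (c * r) (prolong a b z (y 1%nat) x)). exact Bx.
  - intros [|n]; [apply prolong_row, Ha0|].
    rewrite prolong_rows. apply Ex.
Qed.

Lemma weyl_solution_peel a b z :
  (forall n, 0 < a n) ->
  has_weyl_solution (fun n => a (S n)) (fun n => b (S n)) z -> has_weyl_solution a b z.
Proof.
  intros Ha [f [Hf [[m Hm] Ef]]]. exists (prolong a b z 0%C f). split; [|split].
  - apply l2_ball_l2 with (Cmod (prolong a b z 0%C f O) + l2norm f).
    apply l2_ball_cons. apply (l2_ball_l2norm f Hf).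
  - exists (S m). exact Hm.
  - intros [|n].
    + apply Ceq_minus. apply prolong_row, Ha.
    + rewrite prolong_rows. apply Ef.
Qed.

(** The first entry and row 0 bound the second entry, which is the first entry for
    the smaller matrix; moving the coupling [a_0 x_0] to its right-hand side
    costs a further multiple of [x_0]. *)
Lemma coercive_up_to_first_peel a b z :
  (forall n, 0 < a n) ->
  coercive_up_to_first (fun n => a (S n)) (fun n => b (S n)) z -> coercive_up_to_first a b z.
Proof.
  intros Ha [c [Hc K]]. assert (Ha0 := Ha O).
  set (k := 1 + (1 + Cmod (b O - z)%C) / a O + a O).
  assert (Hbz := Cmod_ge_0 (b O - z)%C).
  assert (Hk : 1 <= k).
  { unfold k. assert (0 <= (1 + Cmod (b O - z)%C) / a O)
      by (apply Rmult_le_pos; [lra | left; apply Rinv_0_lt_compat, Ha0]). lra. }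
  exists (1 + c * k). split; [nra|].
  intros r y x Hx Hy E.
  assert (Hr : 0 <= r) by apply Hy. assert (Hx0 := Cmod_ge_0 (x O)).
  assert (By0 := l2_ball_coord _ _ 0 Hy).
  assert (H1 : Cmod (x 1%nat) <= (r + Cmod (b O - z)%C * Cmod (x O)) / a O).
  { assert (X1 : x 1%nat = ((y O - (b O - z) * x O) / a O)%C).
    { rewrite <- (E O). simpl. field. apply RtoC_pos_neq0, Ha0. }
    rewrite X1, Cmod_div, Cmod_R, (Rabs_pos_eq (a O)) by (try apply RtoC_pos_neq0; lra).
    apply Rmult_le_compat_r; [left; apply Rinv_0_lt_compat, Ha0|].
    assert (T := Cmod_triangle (y O) (- ((b O - z) * x O))%C).
    rewrite Cmod_opp, Cmod_mult in T. unfold Cminus in *. lra. }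
  assert (B : l2_ball (c * (Cmod (x 1%nat) + (r + a O * Cmod (x O)))) (fun n => x (S n))).
  { apply (K (r + a O * Cmod (x O))
      (fun n => y (S n) + match n with O => - (a O * x O) | S _ => 0 end)%C (fun n => x (S n))).
    - apply (l2_ball_l2 (l2norm x)), (l2_ball_tail _ x), l2_ball_l2norm, Hx.
    - apply l2_ball_plus; [apply l2_ball_tail, Hy|]. apply l2_ball_first.
      rewrite Cmod_opp, Cmod_mult, Cmod_R, Rabs_pos_eq; [apply Rle_refl | lra].
    - intros [|n]; rewrite <- E; simpl; ring. }
  apply (l2_ball_le (Cmod (x O) + c * (Cmod (x 1%nat) + (r + a O * Cmod (x O))))).
  - rewrite Rmult_plus_distr_r, Rmult_1_l.
    apply Rplus_le_compat; [lra|]. rewrite Rmult_assoc.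
    apply Rmult_le_compat_l; [exact Hc|].
    apply Rle_trans with ((r + Cmod (b O - z)%C * Cmod (x O)) / a O + (r + a O * Cmod (x O)));
      [lra|].
    assert (Hi : 0 < / a O) by (apply Rinv_0_lt_compat, Ha0).
    assert (0 <= / a O * Cmod (x O)) by nra. assert (0 <= a O * r) by nra.
    assert (0 <= Cmod (b O - z)%C * (/ a O * r)) by (apply Rmult_le_pos; nra).
    unfold k, Rdiv. lra.
  - apply l2_ball_cons, B.
Qed.

Lemma peel_rows (Q : (nat -> R) -> (nat -> R) -> Prop) :
  (forall a b, (forall n, 0 < a n) -> Q (fun n => a (S n)) (fun n => b (S n)) -> Q a b) ->
  forall L a b, (forall n, 0 < a n) ->
  Q (fun n => a (L + n)%nat) (fun n => b (L + n)%nat) -> Q a b.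
Proof.
  intros H. induction L as [|L IH]; intros a b Ha HQ; [exact HQ|].
  apply H; [exact Ha|]. apply IH; [intros; apply Ha | exact HQ].
Qed.

Lemma tail_solvable_of_solvable a b z c : 0 <= c -> solvable a b z c -> tail_solvable a b z.
Proof.
  intros Hc H. exists c. split; [exact Hc|]. intros r y Hy.
  destruct (H r y Hy) as [x [Bx Ex]]. exists x. split; [exact Bx | intros; apply Ex].
Qed.

(** The solution with source at index 0 solves all other rows, and it is nonzero
    because the source is. *)
Lemma weyl_solution_of_solvable a b z c : solvable a b z c -> has_weyl_solution a b z.
Proof.
  intros H.
  destruct (H 1 (fun n => match n with O => 1%C | S _ => 0%C end)) as [f [Bf Ef]].
  { apply l2_ball_first. rewrite Cmod_1. lra. }
  exists f. split; [apply (l2_ball_l2 _ _ Bf)|]. split.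
  - apply NNPP. intros N.
    assert (Z : forall n, f n = 0%C) by (intros n; apply NNPP; intros F; apply N; exists n; exact F).
    specialize (Ef O). simpl in Ef. rewrite !Z in Ef.
    apply C1_nz. rewrite <- Ef. ring.
  - intros n. apply Ceq_minus. apply Ef.
Qed.

Lemma coercive_up_to_first_of_coercive a b z c :
  0 <= c -> coercive a b z c -> coercive_up_to_first a b z.
Proof.
  intros Hc K. exists c. split; [exact Hc|]. intros r y x Hx Hy E.
  apply (l2_ball_le (c * r)); [|exact (K r y x Hx Hy E)].
  assert (0 <= Cmod (x O)) by apply Cmod_ge_0. nra.
Qed.

(** The Fredholm alternative.  Row 0 is repaired by adding a multiple of the Weyl
    solution [f]; this works unless [f] satisfies row 0 as well, in which case it
    is an eigenvector. *)
Lemma solvable_of_tail_solvable a b z :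
  tail_solvable a b z -> has_weyl_solution a b z -> injective_on_l2 a b z ->
  exists c, solvable a b z c.
Proof.
  intros [c [Hc Hs]] [f [Hf [[m Hm] Ef]]] I.
  (* The Jost function: its zeros are the eigenvalues. *)
  set (D := (jacobi_matrix a b f O - z * f O)%C).
  assert (HD : D <> 0%C).
  { intros F. apply Hm. apply I; [exact Hf|]. intros [|n]; [|apply Ef].
    apply Ceq_minus, F. }
  assert (HD' : 0 < Cmod D) by (apply Cmod_gt_0, HD).
  set (k0 := (1 + Cmod (b O - z)%C * c + Rabs (a O) * c) / Cmod D).
  exists (c + k0 * l2norm f). intros r y Hy.
  destruct (Hs r y Hy) as [x [Bx Ex]].
  set (k := ((y O - (jacobi_matrix a b x O - z * x O)) / D)%C).
  assert (Hk : Cmod k <= k0 * r).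
  { unfold k, k0. rewrite Cmod_div by exact HD. unfold Rdiv.
    rewrite (Rmult_comm _ r), <- Rmult_assoc.
    apply Rmult_le_compat_r; [left; apply Rinv_0_lt_compat, HD'|].
    assert (B0 := l2_ball_coord _ _ 0 Bx). assert (B1 := l2_ball_coord _ _ 1 Bx).
    assert (By := l2_ball_coord _ _ 0 Hy).
    assert (Hbz := Cmod_ge_0 (b O - z)%C). assert (Ha := Rabs_pos (a O)).
    replace (y O - (jacobi_matrix a b x O - z * x O))%C
      with ((y O + - ((b O - z) * x O)) + - (a O * x 1%nat))%C by (simpl; ring).
    assert (T1 := Cmod_triangle (y O + - ((b O - z) * x O))%C (- (a O * x 1%nat))%C).
    assert (T2 := Cmod_triangle (y O) (- ((b O - z) * x O))%C).
    rewrite Cmod_opp, Cmod_mult in T1, T2. rewrite Cmod_R in T1. nra. }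
  exists (fun n => x n + k * f n)%C. split.
  - apply (l2_ball_le (c * r + Cmod k * l2norm f)).
    + assert (P := l2norm_ge0 f). nra.
    + apply l2_ball_plus; [exact Bx | apply l2_ball_scal, l2_ball_l2norm, Hf].
  - intros n. rewrite jacobi_plus_scal.
    replace (_ - _)%C with ((jacobi_matrix a b x n - z * x n)
                            + k * (jacobi_matrix a b f n - z * f n))%C by ring.
    destruct n as [|n].
    + fold D. unfold k. field. exact HD.
    + rewrite Ex, Ef. ring.
Qed.

(** * Resolvent set and eigenvalues *)

Lemma l2_jacobi_of_equation a b z r x y :
  l2 x -> l2_ball r y -> (forall n, (jacobi_matrix a b x n - z * x n)%C = y n) ->
  l2 (jacobi_matrix a b x).
Proof.
  intros Hx Hy E. apply (l2_ball_l2 (r + Cmod z * l2norm x)).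
  apply l2_ball_ext with (fun n => y n + z * x n)%C.
  - intros n. rewrite <- E. ring.
  - apply l2_ball_plus; [exact Hy | apply l2_ball_scal, l2_ball_l2norm, Hx].
Qed.

Lemma in_resolvent_set_of_solvable a b z c :
  injective_on_l2 a b z -> solvable a b z c -> in_resolvent_set (jacobi_operator a b) z.
Proof.
  intros I Hs.
  destruct (functional_choice (fun y x => l2 y -> l2_ball (c * l2norm y) x /\
      forall n, (jacobi_matrix a b x n - z * x n)%C = y n)) as [G HG].
  { intros y. destruct (classic (l2 y)) as [Hy|Hy].
    - destruct (Hs _ y (l2_ball_l2norm y Hy)) as [x Hx]. exists x. intros _. exact Hx.
    - exists y. intros Hy'. contradiction. }
  exists G, c. split.
  - intros y Hy. destruct (HG y Hy) as [B E]. destruct (l2_ball_l2 _ _ B) as [Hx Nx].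
    split; [split; [exact Hx|] | split; [exact E | exact Nx]].
    apply (l2_jacobi_of_equation a b z (l2norm y) (G y) y);
      [exact Hx | apply l2_ball_l2norm, Hy | exact E].
  - intros x [Hx HA]. split; [exact HA|].
    assert (Hy : l2 (fun m => jacobi_matrix a b x m - z * x m)%C).
    { apply (l2_ball_l2 (l2norm (jacobi_matrix a b x) + Cmod (- z)%C * l2norm x)).
      apply l2_ball_ext with (fun m => jacobi_matrix a b x m + - z * x m)%C; [intros; ring|].
      apply l2_ball_plus; [|apply l2_ball_scal]; apply l2_ball_l2norm; assumption. }
    destruct (HG _ Hy) as [B E].
    apply (solution_unique a b z); [exact I | apply (l2_ball_l2 _ _ B) | exact Hx | exact E].
Qed.

Lemma eigenspace_intro a b z x :
  l2 x -> (forall n, jacobi_matrix a b x n = (z * x n)%C) ->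
  eigenspace (jacobi_operator a b) z x.
Proof.
  intros Hx E. split; [split; [exact Hx|] | exact E].
  apply (l2_ball_l2 (Cmod z * l2norm x)).
  apply l2_ball_ext with (fun n => z * x n)%C; [intros n; rewrite <- E; reflexivity|].
  apply l2_ball_scal, l2_ball_l2norm, Hx.
Qed.

Lemma injective_of_not_eigenvalue a b z :
  ~ is_eigenvalue (jacobi_operator a b) z -> injective_on_l2 a b z.
Proof.
  intros N x Hx E n. apply NNPP. intros F. apply N. exists x. split.
  - apply eigenspace_intro; assumption.
  - exists n. exact F.
Qed.

Lemma solution_zero_of_first_zero a b z x :
  (forall n, 0 < a n) -> (forall n, jacobi_matrix a b x n = (z * x n)%C) -> x O = 0%C ->
  forall n, x n = 0%C.
Proof.
  intros Ha E H0.
  assert (P : forall n, x n = 0%C /\ x (S n) = 0%C).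
  { induction n as [|n [IH1 IH2]].
    - split; [exact H0|]. specialize (E O). simpl in E. rewrite H0 in E.
      apply NNPP. intros F. apply (Cmult_neq_0 (a O) (x 1%nat)).
      + apply RtoC_pos_neq0, Ha.
      + exact F.
      + transitivity (b O * 0 + a O * x 1%nat)%C; [ring|]. rewrite E. ring.
    - split; [exact IH2|]. specialize (E (S n)). simpl in E. rewrite IH1, IH2 in E.
      apply NNPP. intros F. apply (Cmult_neq_0 (a (S n)) (x (S (S n)))).
      + apply RtoC_pos_neq0, Ha.
      + exact F.
      + transitivity (a n * 0 + b (S n) * 0 + a (S n) * x (S (S n)))%C; [ring|].
        rewrite E. ring. }
  intros n. apply P.
Qed.

Lemma normalized_eigenvector a b z :
  (forall n, 0 < a n) -> is_eigenvalue (jacobi_operator a b) z ->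
  exists v, l2 v /\ v O = 1%C /\ forall n, jacobi_matrix a b v n = (z * v n)%C.
Proof.
  intros Ha [x [[[Hx _] E] [m Hm]]]. simpl in E.
  assert (H0 : x O <> 0%C) by (intros F; apply Hm; exact (solution_zero_of_first_zero a b z x Ha E F m)).
  exists (fun n => / x O * x n)%C. split; [|split].
  - apply (l2_ball_l2 (Cmod (/ x O)%C * l2norm x)). apply l2_ball_scal, l2_ball_l2norm, Hx.
  - apply Cinv_l, H0.
  - intros n.
    transitivity (jacobi_matrix a b (fun m => 0 + / x O * x m)%C n).
    { destruct n; simpl; ring. }
    rewrite (jacobi_plus_scal a b (fun _ => 0%C)), E. destruct n; simpl; ring.
Qed.

Lemma jacobi_finite_multiplicity a b z :
  (forall n, 0 < a n) -> is_eigenvalue (jacobi_operator a b) z ->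
  finite_multiplicity (jacobi_operator a b) z.
Proof.
  intros Ha Ev. destruct (normalized_eigenvector a b z Ha Ev) as [v [Hv [v0 Ev']]].
  exists O, (fun _ => v). split.
  - intros _ _. apply eigenspace_intro; assumption.
  - intros x [_ Ex]. simpl in Ex. exists (fun _ => x O). intros n. rewrite sum_O.
    apply Ceq_minus. replace (x n - x O * v n)%C with (x n + (- x O) * v n)%C by ring.
    apply (solution_zero_of_first_zero a b z (fun n => x n + (- x O) * v n)%C Ha).
    + intros m. rewrite jacobi_plus_scal, Ex, Ev'. ring.
    + rewrite v0. ring.
Qed.

(** * Orthogonality of eigenvectors and isolation of eigenvalues *)

Lemma harmonic_unbounded B : exists K, B < sum_n (fun k => / INR (S k)) K.
Proof.
  assert (L : forall K, ln (INR (S (S K))) <= sum_n (fun k => / INR (S k)) K).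
  { assert (St : forall K, ln (INR (S (S K))) <= ln (INR (S K)) + / INR (S K)).
    { intros K. assert (H : 0 < INR (S K)) by (apply lt_0_INR; lia).
      assert (Hi : 0 < / INR (S K)) by (apply Rinv_0_lt_compat, H).
      rewrite <- (ln_exp (/ INR (S K))) at 1. rewrite <- ln_mult by (try apply exp_pos; exact H).
      apply ln_le; [apply lt_0_INR; lia|].
      assert (Ex := exp_ineq1_le (/ INR (S K))). rewrite (S_INR (S K)).
      apply Rle_trans with (INR (S K) * (1 + / INR (S K))); [right; field; lra|].
      apply Rmult_le_compat_l; lra. }
    induction K as [|K IH].
    - rewrite sum_O. specialize (St O). simpl INR in *. rewrite ln_1 in St. lra.
    - rewrite sumR_S. specialize (St (S K)). lra. }
  destruct (nfloor_ex (exp B)) as [K [_ HK]]; [left; apply exp_pos|].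
  exists K. eapply Rlt_le_trans; [|apply L].
  rewrite <- (ln_exp B). apply ln_increasing; [apply exp_pos|].
  rewrite !S_INR. lra.
Qed.

(** Lagrange's identity against the null solution [p]: where [p] vanishes at [M],
    the boundary term is [a_M x_M] up to a factor of modulus 1, and
    Cauchy-Schwarz bounds the sum by the square root of its length. *)
Lemma boundary_value_bound a b p C0 r x y M :
  (forall n, jacobi_matrix a b p n = 0%C) -> (forall n, Cmod (p n) <= C0) ->
  p M = 0%C -> Cmod (p (S M)) = 1 ->
  l2_ball r y -> (forall n, jacobi_matrix a b x n = y n) ->
  Cmod (a M * x M)%C <= C0 * r * sqrt (INR (S M)).
Proof.
  intros Hp HC p0 p1 [Hr Hy] E.
  assert (HC0 : 0 <= C0) by (eapply Rle_trans; [apply Cmod_ge_0 | apply (HC O)]).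
  assert (L := lagrange_identity a b x p M). rewrite p0 in L.
  replace (a M * (x (S M) * 0 - x M * p (S M)))%C with (- (a M * x M * p (S M)))%C in L by ring.
  assert (N : Cmod (a M * x M)%C = Cmod (- (a M * x M * p (S M)))%C).
  { rewrite Cmod_opp, (Cmod_mult (_ * _)), p1, Rmult_1_r. reflexivity. }
  rewrite N, <- L. eapply Rle_trans; [apply Cmod_sum_le|].
  apply Rle_trans with (sum_n (fun m => C0 * (Cmod (y m) * 1)) M).
  - apply sumR_le. intros m _. rewrite Hp, E.
    replace (y m * p m - x m * 0)%C with (p m * y m)%C by ring.
    rewrite Cmod_mult, Rmult_1_r. apply Rmult_le_compat_r; [apply Cmod_ge_0 | apply HC].
  - rewrite sumR_scal, Rmult_assoc. apply Rmult_le_compat_l; [exact HC0|].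
    apply sumR_cauchy_schwarz_bound; [exact Hr | apply sqrt_pos | apply Hy |].
    rewrite pow2_sqrt by apply pos_INR.
    eapply Rle_trans; [apply (sumR_const_le _ 1)|]; [intros; lra | lra].
Qed.

(** The features of the bounded null solution that control boundary terms at the
    ends of the blocks. *)
Record nodal_solution (N : nat) (a b : nat -> R) (p : nat -> C) (C0 : R) : Prop := {
  ns_period : (0 < N)%nat;
  ns_solves : forall n, jacobi_matrix a b p n = 0%C;
  ns_bound : forall n, Cmod (p n) <= C0;
  ns_node : forall k, p (k * N + (N - 1))%nat = 0%C;
  ns_unit : forall k, Cmod (p (k * N)%nat) = 1
}.

(** This is the orthogonality of eigenvectors, for the bilinear pairing.  By
    Lagrange's identity [(w - z)] times the partial pairing is a boundary term.
    At the end of block [k] it is at most a multiple of [sqrt (k + 1)] times the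
    next entries of [u] and [g].  If it stayed away from 0, the squares of these
    entries would dominate a multiple of the harmonic series. *)
Lemma eigenvectors_pairing_not_bounded_below a b p C0 N w z u g delta :
  nodal_solution N a b p C0 ->
  l2 u -> (forall n, jacobi_matrix a b u n = (w * u n)%C) ->
  l2 g -> (forall n, jacobi_matrix a b g n = (z * g n)%C) ->
  w <> z -> 0 < delta ->
  ~ (forall M, delta <= Cmod (sum_n (fun n => u n * g n)%C M)).
Proof.
  intros [HN Hp HC pz p1] Hu Eu Hg Eg Hwz Hd H.
  assert (HC0 : 0 <= C0) by (eapply Rle_trans; [apply Cmod_ge_0 | apply (HC O)]).
  assert (Bu := l2_ball_l2norm u Hu). assert (Bg := l2_ball_l2norm g Hg).
  assert (Nu := l2norm_ge0 u). assert (Ng := l2norm_ge0 g).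
  assert (Hw : 0 < Cmod (w - z)%C) by (apply Cmod_gt_0, Cminus_eq_contra, Hwz).
  set (d := Cmod (w - z)%C * delta).
  assert (Hd' : 0 < d) by (apply Rmult_lt_0_compat; assumption).
  set (D := C0 * (Cmod w * l2norm u + Cmod z * l2norm g)).
  assert (HD : 0 <= D).
  { apply Rmult_le_pos; [exact HC0|]. assert (0 <= Cmod w) by apply Cmod_ge_0.
    assert (0 <= Cmod z) by apply Cmod_ge_0. nra. }
  set (h := fun n => Cmod (u n) ^ 2 + Cmod (g n) ^ 2).
  assert (Hh : forall n, 0 <= h n).
  { intros n. unfold h. assert (A1 := pow2_ge_0 (Cmod (u n))).
    assert (A2 := pow2_ge_0 (Cmod (g n))). lra. }
  assert (Key : forall k, d ^ 2 * / INR (S k) <= 2 * D ^ 2 * INR N * h (S k * N)%nat).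
  { intros k. set (M := (k * N + (N - 1))%nat).
    assert (SM : S M = (S k * N)%nat) by (unfold M; simpl; lia).
    assert (p1' : Cmod (p (S M)) = 1) by (rewrite SM; apply p1).
    assert (X1 := boundary_value_bound a b p C0 _ u _ M Hp HC (pz k) p1'
                    (l2_ball_scal _ w _ Bu) Eu).
    assert (X2 := boundary_value_bound a b p C0 _ g _ M Hp HC (pz k) p1'
                    (l2_ball_scal _ z _ Bg) Eg).
    set (s := sqrt (INR (S M))) in *.
    assert (Hs : 0 <= s) by apply sqrt_pos.
    assert (Hs2 : s ^ 2 = INR (S k) * INR N).
    { unfold s. rewrite pow2_sqrt by apply pos_INR. rewrite SM. apply mult_INR. }
    assert (L := lagrange_identity a b u g M).
    assert (L' : sum_n (fun m => jacobi_matrix a b u m * g m - u m * jacobi_matrix a b g m)%C M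
                 = ((w - z) * sum_n (fun n => u n * g n) M)%C :> C).
    { rewrite <- sumC_scal. apply sum_n_ext. intros n. rewrite Eu, Eg.
      change ((w * u n * g n - u n * (z * g n))%C = ((w - z) * (u n * g n))%C). ring. }
    rewrite L' in L.
    assert (B1 : d <= D * s * (Cmod (u (S M)) + Cmod (g (S M)))).
    { apply Rle_trans with (Cmod ((w - z) * sum_n (fun n => u n * g n) M)%C).
      - rewrite Cmod_mult. apply Rmult_le_compat_l; [lra | apply H].
      - rewrite L.
        replace (a M * (u (S M) * g M - u M * g (S M)))%C
          with ((a M * g M) * u (S M) + - ((a M * u M) * g (S M)))%C by ring.
        eapply Rle_trans; [apply Cmod_triangle|]. rewrite Cmod_opp, !(Cmod_mult (_ * _)).
        assert (A1 := Cmod_ge_0 (u (S M))). assert (A2 := Cmod_ge_0 (g (S M))).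
        assert (W1 : C0 * (Cmod w * l2norm u) * s <= D * s).
        { apply Rmult_le_compat_r; [exact Hs|]. unfold D. apply Rmult_le_compat_l; [exact HC0|].
          assert (0 <= Cmod z) by apply Cmod_ge_0. nra. }
        assert (W2 : C0 * (Cmod z * l2norm g) * s <= D * s).
        { apply Rmult_le_compat_r; [exact Hs|]. unfold D. apply Rmult_le_compat_l; [exact HC0|].
          assert (0 <= Cmod w) by apply Cmod_ge_0. nra. }
        nra. }
    assert (Hk : 0 < INR (S k)) by (apply lt_0_INR; lia).
    rewrite SM in B1. unfold h.
    set (q1 := Cmod (u (S k * N)%nat)) in *. set (q2 := Cmod (g (S k * N)%nat)) in *.
    apply Rmult_le_reg_r with (INR (S k)); [exact Hk|].
    replace (d ^ 2 * / INR (S k) * INR (S k)) with (d ^ 2) by (field; lra).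
    replace (2 * D ^ 2 * INR N * (q1 ^ 2 + q2 ^ 2) * INR (S k))
      with (D ^ 2 * (INR (S k) * INR N) * (2 * (q1 ^ 2 + q2 ^ 2))) by ring.
    rewrite <- Hs2.
    apply Rle_trans with ((D * s * (q1 + q2)) ^ 2).
    - apply pow_incr. lra.
    - rewrite !Rpow_mult_distr. apply Rmult_le_compat_l.
      + rewrite <- Rpow_mult_distr. apply pow2_ge_0.
      + assert (0 <= (q1 - q2) ^ 2) by apply pow2_ge_0. nra. }
  assert (Hh2 : forall K, sum_n (fun k => h (S k * N)%nat) K <= l2norm u ^ 2 + l2norm g ^ 2).
  { intros K. apply Rle_trans with (sum_n (fun k => h (k * N)%nat) (S K)).
    - rewrite (sumR_shift (fun k => h (k * N)%nat)). specialize (Hh (0 * N)%nat). lra.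
    - eapply Rle_trans; [apply sumR_multiples; assumption|].
      unfold h. rewrite sumR_plus. apply Rplus_le_compat; [apply Bu | apply Bg]. }
  set (Q := 2 * D ^ 2 * INR N * (l2norm u ^ 2 + l2norm g ^ 2)).
  destruct (harmonic_unbounded (Q / d ^ 2)) as [K HK].
  assert (F : d ^ 2 * sum_n (fun k => / INR (S k)) K <= Q).
  { rewrite <- sumR_scal.
    apply Rle_trans with (sum_n (fun k => 2 * D ^ 2 * INR N * h (S k * N)%nat) K).
    - apply sumR_le. intros k _. apply Key.
    - rewrite (sumR_scal (2 * D ^ 2 * INR N)). unfold Q. apply Rmult_le_compat_l; [|apply Hh2].
      apply Rmult_le_pos; [|apply pos_INR]. nra. }
  assert (Hd2 : 0 < d ^ 2) by (apply pow_lt, Hd').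
  apply (Rmult_lt_compat_l (d ^ 2)) in HK; [|exact Hd2].
  replace (d ^ 2 * (Q / d ^ 2)) with Q in HK by (field; lra). lra.
Qed.

Lemma jacobi_conj a b (x : nat -> C) n :
  jacobi_matrix a b (fun m => Cconj (x m)) n = Cconj (jacobi_matrix a b x n).
Proof.
  assert (Hc : forall r, Cconj (RtoC r) = RtoC r).
  { intros r. unfold Cconj, RtoC. simpl. f_equal. ring. }
  destruct n; simpl; rewrite ?Cplus_conj, !Cmult_conj, !Hc; reflexivity.
Qed.

Lemma l2_conj x : l2 x -> l2 (fun n => Cconj (x n)).
Proof.
  intros H. apply (l2_ball_l2 (1 * l2norm x)).
  apply l2_ball_dominated with x; [lra | apply l2_ball_l2norm, H |].
  intros n. rewrite Cmod_conj. lra.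
Qed.

Lemma sum_mult_conj_ge1 (v : nat -> C) M :
  v O = 1%C -> 1 <= Re (sum_n (fun n => v n * Cconj (v n))%C M).
Proof.
  intros v0.
  assert (E : sum_n (fun n => v n * Cconj (v n))%C M
              = RtoC (sum_n (fun n => Cmod (v n) ^ 2) M) :> C).
  { induction M as [|M IH].
    - rewrite !sum_O. symmetry. apply Cmod2_conj.
    - rewrite sumC_S, sumR_S, IH, RtoC_plus. f_equal. symmetry. apply Cmod2_conj. }
  rewrite E, re_RtoC.
  apply Rle_trans with (Cmod (v O) ^ 2).
  - rewrite v0, Cmod_1. lra.
  - apply (sumR_term_le (fun n => Cmod (v n) ^ 2)); [intros; apply pow2_ge_0 | lia].
Qed.

(** Let [v] and [u] be eigenvectors to [z] and to a nearby [w], both with first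
    entry 1, and [d = u - v].  As [d] vanishes at 0 and
    [(A - z) d = (w - z) u], the estimate [coercive_up_to_first] makes [d] small,
    so the pairing of [u] with the conjugate of [v] stays near the squared norm
    of [v], which is at least 1; but it should vanish if [w <> z].  The pairing
    of [v] with its own conjugate first shows that [z] is real. *)
Lemma eigenvalue_isolated a b p C0 N z :
  (forall n, 0 < a n) -> nodal_solution N a b p C0 ->
  coercive_up_to_first a b z -> is_eigenvalue (jacobi_operator a b) z ->
  exists eps, 0 < eps /\
    forall w, is_eigenvalue (jacobi_operator a b) w -> Cmod (w - z) < eps -> w = z.
Proof.
  intros Ha Hp [c [Hc K]] Ez.
  destruct (normalized_eigenvector a b z Ha Ez) as [v [Hv [v0 Ev]]].
  assert (Hcv := l2_conj v Hv).
  assert (Ecv : forall n, jacobi_matrix a b (fun n => Cconj (v n)) n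
                          = (Cconj z * Cconj (v n))%C).
  { intros n. rewrite jacobi_conj, Ev, Cmult_conj. reflexivity. }
  assert (Hz : z = Cconj z).
  { apply NNPP. intros F.
    apply (eigenvectors_pairing_not_bounded_below a b p C0 N z (Cconj z) v
             (fun n => Cconj (v n)) 1 Hp Hv Ev Hcv Ecv F Rlt_0_1).
    intros M. eapply Rle_trans; [apply (sum_mult_conj_ge1 v M v0)|].
    eapply Rle_trans; [apply Rle_abs | apply re_le_Cmod]. }
  rewrite <- Hz in Ecv.
  set (V := l2norm v). assert (HV : 0 <= V) by apply l2norm_ge0.
  assert (Bv := l2_ball_l2norm v Hv). fold V in Bv.
  (* Makes the norm [X] of [d] at most [/ (2 V)], from [X <= c t (X + V)]. *)
  set (eps := / (4 * ((c + 1) * (V ^ 2 + 1)))).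
  assert (Hden : 0 < (c + 1) * (V ^ 2 + 1)) by (apply Rmult_lt_0_compat; nra).
  assert (Heps : 0 < eps) by (apply Rinv_0_lt_compat; lra).
  exists eps. split; [exact Heps|]. intros w Ew Hwz.
  apply NNPP. intros F.
  destruct (normalized_eigenvector a b w Ha Ew) as [u [Hu [u0 Eu]]].
  set (d := fun n => (u n + - (1) * v n)%C).
  assert (Hd : l2 d).
  { apply (l2_ball_l2 (l2norm u + Cmod (- (1))%C * V)).
    apply l2_ball_plus; [apply l2_ball_l2norm, Hu | apply l2_ball_scal, Bv]. }
  set (X := l2norm d). assert (HX : 0 <= X) by apply l2norm_ge0.
  assert (Bd := l2_ball_l2norm d Hd). fold X in Bd.
  set (t := Cmod (w - z)%C) in *. assert (Ht : 0 <= t) by apply Cmod_ge_0.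
  assert (Small : X * V <= / 2).
  { assert (B : l2_ball (c * (Cmod (d O) + t * (X + V))) d).
    { apply (K _ (fun n => (w - z) * (d n + v n))%C); [exact Hd | |].
      - apply l2_ball_scal, l2_ball_plus; assumption.
      - intros n. unfold d. rewrite jacobi_plus_scal, Eu, Ev. ring. }
    assert (d0 : Cmod (d O) = 0).
    { unfold d. rewrite u0, v0. replace (1 + - (1) * 1)%C with (RtoC 0) by ring. apply Cmod_0. }
    rewrite d0 in B.
    assert (NX := proj2 (l2_ball_l2 _ _ B)). fold X in NX.
    assert (E1 : 4 * ((c + 1) * (V ^ 2 + 1)) * t <= 1).
    { apply Rle_trans with (4 * ((c + 1) * (V ^ 2 + 1)) * eps).
      - apply Rmult_le_compat_l; lra.
      - unfold eps. right. field. split; nra. }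
    assert (E2 : 0 <= c * t) by (apply Rmult_le_pos; assumption).
    assert (E3 : 4 * (c * t) * (V ^ 2 + 1) <= 1) by nra.
    assert (E4 : c * t <= / 4) by nra.
    assert (E5 : X <= 2 * (c * t) * V) by nra.
    nra. }
  apply (eigenvectors_pairing_not_bounded_below a b p C0 N w z u
           (fun n => Cconj (v n)) (/ 2) Hp Hu Eu Hcv Ecv F ltac:(lra)).
  intros M.
  assert (S1 : sum_n (fun n => u n * Cconj (v n))%C M
     = (sum_n (fun n => v n * Cconj (v n)) M + sum_n (fun n => d n * Cconj (v n)) M)%C :> C).
  { rewrite <- sumC_plus. apply sum_n_ext. intros n. unfold d.
    change ((u n * Cconj (v n))%C = (v n * Cconj (v n) + (u n + - (1) * v n) * Cconj (v n))%C).
    ring. }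
  assert (S2 : Cmod (sum_n (fun n => d n * Cconj (v n))%C M) <= X * V).
  { eapply Rle_trans; [apply Cmod_sum_le|].
    apply Rle_trans with (sum_n (fun n => Cmod (d n) * Cmod (v n)) M).
    - apply sumR_le. intros n _. rewrite Cmod_mult, Cmod_conj. lra.
    - apply sumR_cauchy_schwarz_bound; [exact HX | exact HV | apply Bd | apply Bv]. }
  assert (S3 := sum_mult_conj_ge1 v M v0).
  rewrite S1. eapply Rle_trans; [|apply re_le_Cmod].
  eapply Rle_trans; [|apply Rle_abs].
  rewrite re_plus.
  assert (S4 := re_le_Cmod (sum_n (fun n => d n * Cconj (v n))%C M)).
  apply Rabs_le_between in S4. lra.
Qed.

(** * Periodic solutions *)

(** The pair of consecutive values at [n] and [n + 1] of the solution of the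
    periodic recurrence that starts with [s]. *)
Fixpoint transfer_orbit (al be : nat -> R) (s : R * R) (n : nat) : R * R :=
  match n with
  | O => s
  | S m => let (x, y) := transfer_orbit al be s m in
           (y, - (al m / al (S m)) * x - be (S m) / al (S m) * y)
  end.

Definition periodic_solution (al be : nat -> R) (u : nat -> R) : Prop :=
  forall n, al n * u n + be (S n) * u (S n) + al (S n) * u (S (S n)) = 0.

Lemma transfer_orbit_solution al be s :
  (forall n, 0 < al n) -> periodic_solution al be (fun n => fst (transfer_orbit al be s n)).
Proof.
  intros H n. simpl. destruct (transfer_orbit al be s n) as [x y]. simpl.
  field. assert (H1 := H (S n)). lra.
Qed.

Lemma coeff_mat_mult2 (A B : @matrix R 2 2) i j :
  (i < 2)%nat -> (j < 2)%nat ->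
  coeff_mat 0 (Mmult A B) i j
  = coeff_mat 0 A i 0 * coeff_mat 0 B 0 j + coeff_mat 0 A i 1 * coeff_mat 0 B 1 j.
Proof.
  intros Hi Hj. unfold Mmult. rewrite (coeff_mat_bij (T := R)) by assumption.
  simpl pred. rewrite sumR_S, sum_O. reflexivity.
Qed.

Lemma coeff_mat_mat2 p q r s :
  coeff_mat 0 (mat2 p q r s) 0 0 = p /\ coeff_mat 0 (mat2 p q r s) 0 1 = q /\
  coeff_mat 0 (mat2 p q r s) 1 0 = r /\ coeff_mat 0 (mat2 p q r s) 1 1 = s.
Proof. repeat split. Qed.

Lemma transfer_orbit_mat_prod alpha beta s n :
  let P := mat_prod (fun i => transfer_matrix alpha beta (Z.of_nat i)) n in
  transfer_orbit (fun i => alpha (Z.of_nat i)) (fun i => beta (Z.of_nat i)) s n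
  = (coeff_mat 0 P 0 0 * fst s + coeff_mat 0 P 0 1 * snd s,
     coeff_mat 0 P 1 0 * fst s + coeff_mat 0 P 1 1 * snd s).
Proof.
  intros P. subst P. destruct s as [s0 s1]. simpl fst; simpl snd.
  induction n as [|n IH].
  - simpl. unfold Mone. rewrite !(coeff_mat_bij (T := R)) by lia. simpl.
    f_equal; change (@one R_Ring) with 1; change (@zero R_Ring) with 0; ring.
  - simpl transfer_orbit. rewrite IH.
    set (P := mat_prod _ n) in *.
    change (mat_prod (fun i => transfer_matrix alpha beta (Z.of_nat i)) (S n))
      with (Mmult (transfer_matrix alpha beta (Z.of_nat (S n))) P).
    rewrite !coeff_mat_mult2 by lia. unfold transfer_matrix.
    destruct (coeff_mat_mat2 0 1 (- (alpha (Z.of_nat (S n) - 1)%Z / alpha (Z.of_nat (S n))))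
                (- (beta (Z.of_nat (S n)) / alpha (Z.of_nat (S n))))) as [-> [-> [-> ->]]].
    replace (Z.of_nat (S n) - 1)%Z with (Z.of_nat n) by lia.
    simpl Z.of_nat. f_equal; ring.
Qed.

(** In terms of the value at index -1, which the periodic row 0 determines, [u]
    starts with [0, 1] and [v] with [1, 0] at the indices [-1, 0].  After one
    period the scalar monodromy reproduces these pairs multiplied by [gamma]. *)
Record floquet_pair (N : nat) (al be : nat -> R) (gamma : R) (u v : nat -> R) : Prop := {
  fp_gamma : Rabs gamma = 1;
  fp_u : periodic_solution al be u;
  fp_u0 : u O = 1;
  fp_u1 : be O * u O + al O * u 1%nat = 0;
  fp_u_last : u (N - 1)%nat = 0;
  fp_u_N : u N = gamma;
  fp_v : periodic_solution al be v;
  fp_v0 : v O = 0;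
  fp_v1 : al O * v 1%nat = - al (N - 1)%nat;
  fp_v_last : v (N - 1)%nat = gamma;
  fp_v_N : v N = 0
}.

(** The monodromy acts on the pair at the indices [0, 1]; the values at [N - 1]
    are recovered from row [N], whose other two terms are by periodicity [gamma]
    times those of row 0. *)
Lemma floquet_pair_exists N alpha beta gamma :
  (0 < N)%nat ->
  (forall n : Z, alpha (n + Z.of_nat N)%Z = alpha n) ->
  (forall n : Z, beta (n + Z.of_nat N)%Z = beta n) ->
  (forall n : Z, 0 < alpha n) ->
  Rabs gamma = 1 ->
  mat_prod (fun i => transfer_matrix alpha beta (Z.of_nat i)) N = mat2 gamma 0 0 gamma ->
  exists u v, floquet_pair N (fun i => alpha (Z.of_nat i)) (fun i => beta (Z.of_nat i)) gamma u v.
Proof.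
  intros HN Pa Pb Ha Hg HP.
  set (al := fun i => alpha (Z.of_nat i)). set (be := fun i => beta (Z.of_nat i)).
  assert (HaN : al N = al O) by (unfold al; rewrite <- (Pa (Z.of_nat 0)); f_equal; lia).
  assert (HbN : be N = be O) by (unfold be; rewrite <- (Pb (Z.of_nat 0)); f_equal; lia).
  assert (Hal : forall n, 0 < al n) by (intros; apply Ha).
  assert (Orb : forall s, transfer_orbit al be s N = (gamma * fst s, gamma * snd s)).
  { intros s. unfold al, be. rewrite transfer_orbit_mat_prod, HP.
    destruct (coeff_mat_mat2 gamma 0 0 gamma) as [-> [-> [-> ->]]]. f_equal; ring. }
  assert (Gen : forall s, exists u,
      periodic_solution al be u /\ u O = fst s /\ u 1%nat = snd s /\ u N = gamma * fst s /\
      al (N - 1)%nat * u (N - 1)%nat = - (gamma * (be O * fst s + al O * snd s))).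
  { intros s. exists (fun n => fst (transfer_orbit al be s n)).
    set (u := fun n => fst (transfer_orbit al be s n)).
    assert (Hu := transfer_orbit_solution al be s Hal). fold u in Hu.
    assert (u1 : u 1%nat = snd s) by (unfold u; simpl; destruct s; reflexivity).
    assert (uN : u N = gamma * fst s) by (unfold u; rewrite Orb; reflexivity).
    assert (uSN : u (S N) = gamma * snd s).
    { unfold u. simpl. assert (O := Orb s). destruct (transfer_orbit al be s N) as [x y].
      simpl. injection O as _ O. exact O. }
    repeat split; try assumption.
    assert (R := Hu (N - 1)%nat). replace (S (N - 1)) with N in R by lia.
    rewrite HaN, HbN, uN, uSN in R. fold (u (N - 1)%nat). lra. }
  assert (H0 := Hal O). assert (H1 := Hal (N - 1)%nat).
  destruct (Gen (1, - (be O / al O))) as [u [Su [u0 [u1 [uN uL]]]]].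
  destruct (Gen (0, - (al (N - 1)%nat / al O))) as [v [Sv [v0 [v1 [vN vL]]]]].
  exists u, v.
  constructor; [exact Hg | exact Su | exact u0 | | | | exact Sv | exact v0 | | |].
  - rewrite u0, u1. simpl. field. lra.
  - simpl in uL. apply Rmult_eq_reg_l with (al (N - 1)%nat); [|lra].
    rewrite uL. field. lra.
  - rewrite uN. simpl. ring.
  - rewrite v1. simpl. field. lra.
  - simpl in vL. apply Rmult_eq_reg_l with (al (N - 1)%nat); [|lra].
    rewrite vL. field. lra.
  - rewrite vN. simpl. ring.
Qed.

(** * Block sequences *)

(** Block [k] is the initial segment of [u] of length [N], scaled by [c k]. *)
Definition blocks (N : nat) (c u : nat -> R) (n : nat) : C :=
  RtoC (c (n / N)%nat * u (n mod N)%nat).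

Lemma blocks_at N c u k i : (i < N)%nat -> blocks N c u (k * N + i)%nat = RtoC (c k * u i).
Proof.
  intros Hi. unfold blocks.
  rewrite Nat.div_add_l, Nat.div_small, Nat.add_0_r by lia.
  rewrite Nat.add_comm, Nat.Div0.mod_add, Nat.mod_small by lia. reflexivity.
Qed.

Lemma block_index N n : (0 < N)%nat -> exists k i, (i < N)%nat /\ n = (k * N + i)%nat.
Proof.
  intros HN. exists (n / N)%nat, (n mod N)%nat. split.
  - apply Nat.mod_upper_bound. lia.
  - rewrite Nat.mul_comm. apply Nat.div_mod_eq.
Qed.

Record modulated (N : nat) (al be ta a b : nat -> R) : Prop := {
  mod_period : (0 < N)%nat;
  mod_al : forall i, 0 < al i;
  mod_ta : forall k, 0 < ta k;
  mod_a : forall k i, (i < N)%nat -> a (k * N + i)%nat = al i * ta k;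
  mod_b : forall k i, (i < N)%nat -> b (k * N + i)%nat = be i * ta k
}.

Lemma modulated_pos N al be ta a b : modulated N al be ta a b -> forall n, 0 < a n.
Proof.
  intros [HN Hal Ht Ea _] n. destruct (block_index N n HN) as [k [i [Hi ->]]].
  rewrite Ea by exact Hi. apply Rmult_lt_0_compat; [apply Hal | apply Ht].
Qed.

(** Inside a block the periodic recurrence makes the rows vanish.  The condition
    on [c] says that the first row of each later block vanishes too, so that
    only two contributions survive: the mismatch at the right end of each block
    and the boundary condition at index 0. *)
Lemma blocks_row N al be ta a b u c :
  modulated N al be ta a b ->
  periodic_solution al be u ->
  (forall k, al (N - 1)%nat * u (N - 1)%nat * (ta k * c k)
             + (be O * u O + al O * u 1%nat) * (ta (S k) * c (S k)) = 0) ->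
  forall k i, (i < N)%nat ->
  jacobi_matrix a b (blocks N c u) (k * N + i)%nat
  = RtoC ((if Nat.eqb (S i) N then al i * ta k * (c (S k) * u O - c k * u N) else 0)
          + (if Nat.eqb (k * N + i) 0 then (be O * u O + al O * u 1%nat) * (ta O * c O) else 0)).
Proof.
  intros [HN _ _ Ea Eb] Hu Hc k i Hi.
  assert (Next : blocks N c u (S (k * N + i))
                 = RtoC (c k * u (S i)
                         + if Nat.eqb (S i) N then c (S k) * u O - c k * u N else 0)).
  { destruct (Nat.eqb_spec (S i) N) as [E|E].
    - replace (S (k * N + i)) with (S k * N + 0)%nat by (simpl; lia).
      rewrite blocks_at by lia. rewrite E. f_equal. ring.
    - replace (S (k * N + i)) with (k * N + S i)%nat by lia.
      rewrite blocks_at by lia. f_equal. ring. }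
  assert (Cur := blocks_at N c u k i Hi).
  assert (Ga := Ea k i Hi). assert (Gb := Eb k i Hi).
  destruct (k * N + i)%nat as [|m] eqn:En.
  - assert (k = O) by nia. assert (i = O) by lia. subst k i.
    unfold jacobi_matrix. rewrite Next, Cur, Ga, Gb. simpl (Nat.eqb 0 0). cbv iota.
    rewrite <- !RtoC_mult, <- RtoC_plus. f_equal.
    destruct (Nat.eqb 1 N); ring.
  - simpl (Nat.eqb (S m) 0). cbv iota. unfold jacobi_matrix. rewrite Next, Cur, Ga, Gb.
    assert (Prev : exists w, (a m * blocks N c u m)%C = RtoC w /\
                     w + (be i * u i + al i * u (S i)) * (ta k * c k) = 0).
    { destruct i as [|i'].
      - destruct k as [|k']; [simpl in En; lia|].
        replace m with (k' * N + (N - 1))%nat by (simpl in En; lia).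
        rewrite Ea, blocks_at, <- RtoC_mult by lia. eexists. split; [reflexivity|].
        rewrite <- (Hc k'). ring.
      - replace m with (k * N + i')%nat by lia.
        rewrite Ea, blocks_at, <- RtoC_mult by lia. eexists. split; [reflexivity|].
        specialize (Hu i'). rewrite <- (Rmult_0_r (ta k * c k)), <- Hu. ring. }
    destruct Prev as [w [-> Hw]].
    rewrite <- !RtoC_mult, <- !RtoC_plus. f_equal.
    replace w with (- ((be i * u i + al i * u (S i)) * (ta k * c k))) by lra.
    destruct (Nat.eqb (S i) N); ring.
Qed.

Lemma bounded_on_prefix (u : nat -> R) N :
  exists C0, 0 <= C0 /\ forall i, (i < N)%nat -> Rabs (u i) <= C0.
Proof.
  exists (sum_n (fun i => Rabs (u i)) N). split.
  - apply sumR_ge0. intros; apply Rabs_pos.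
  - intros i Hi. apply (sumR_term_le (fun i => Rabs (u i))); [intros; apply Rabs_pos | lia].
Qed.

Lemma gamma_pow_abs gamma k : Rabs gamma = 1 -> Rabs (gamma ^ k) = 1.
Proof. intros H. rewrite <- RPow_abs, H. apply pow1. Qed.

(** For the two scalings of [blocks_row] the mismatch at the right end is zero:
    [u] and [gamma^k] are compatible because [u_N = gamma u_0], and [v] with any
    scaling because [v_0 = v_N = 0].  The factor [1 / ta_k] in [q] is what
    cancels the change of the off-diagonal entry between two blocks. *)
Lemma floquet_zero_energy_pair N al be gamma u v ta a b :
  modulated N al be ta a b -> floquet_pair N al be gamma u v ->
  zero_energy_pair a b (blocks N (fun k => gamma ^ k) u) (blocks N (fun k => gamma ^ k / ta k) v)
    (al (N - 1)%nat).
Proof.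
  intros Mod [Hg Su u0 u1 uL uN Sv v0 v1 vL vN].
  assert (HN := mod_period _ _ _ _ _ _ Mod). assert (Ht := mod_ta _ _ _ _ _ _ Mod).
  assert (Cu : forall k, al (N - 1)%nat * u (N - 1)%nat * (ta k * gamma ^ k)
             + (be O * u O + al O * u 1%nat) * (ta (S k) * gamma ^ (S k)) = 0).
  { intros k. rewrite u1, uL. ring. }
  assert (Cv : forall k, al (N - 1)%nat * v (N - 1)%nat * (ta k * (gamma ^ k / ta k))
             + (be O * v O + al O * v 1%nat) * (ta (S k) * (gamma ^ (S k) / ta (S k))) = 0).
  { intros k. rewrite v0, v1, vL. assert (H1 := Ht k). assert (H2 := Ht (S k)).
    simpl pow. field. lra. }
  assert (Rv := blocks_row N al be ta a b v (fun k => gamma ^ k / ta k) Mod Sv Cv).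
  constructor.
  - rewrite (blocks_at N _ u 0 0 HN : blocks N _ u O = _). rewrite u0. simpl. f_equal. ring.
  - intros n. destruct (block_index N n HN) as [k [i [Hi ->]]].
    rewrite (blocks_row N al be ta a b u (fun k => gamma ^ k) Mod Su Cu k i Hi).
    f_equal. rewrite u0, uN. rewrite u0 in u1. rewrite u1.
    destruct (Nat.eqb (S i) N), (Nat.eqb (k * N + i) 0); simpl; ring.
  - rewrite (blocks_at N _ v 0 0 HN : blocks N _ v O = _). rewrite v0. f_equal. ring.
  - specialize (Rv O O HN). simpl (0 * N + 0)%nat in Rv. rewrite Rv, <- RtoC_opp. f_equal.
    rewrite v0, vN, v1. simpl (Nat.eqb 0 0). cbv iota. assert (H0 := Ht O). assert (H1 := Ht 1%nat).
    destruct (Nat.eqb 1 N); simpl; field; lra.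
  - intros n. destruct (block_index N (S n) HN) as [k [i [Hi En]]]. rewrite En, Rv, <- En by exact Hi.
    rewrite v0, vN. simpl (Nat.eqb (S n) 0). cbv iota. f_equal.
    destruct (Nat.eqb (S i) N); ring.
Qed.

Lemma blocks_bound N c u C0 n :
  (0 < N)%nat -> (forall i, (i < N)%nat -> Rabs (u i) <= C0) ->
  Cmod (blocks N c u n) <= C0 * Rabs (c (n / N)%nat).
Proof.
  intros HN Hu. unfold blocks. rewrite Cmod_R, Rabs_mult, Rmult_comm.
  apply Rmult_le_compat_r; [apply Rabs_pos|]. apply Hu, Nat.mod_upper_bound. lia.
Qed.

(** The constant depends on the modulation only through [eps]; this uniformity is
    what makes the inverse small after the deletion of many blocks. *)
Lemma floquet_solvable N al be gamma u v C0 ta a b eps :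
  modulated N al be ta a b -> floquet_pair N al be gamma u v ->
  (forall i, (i < N)%nat -> Rabs (u i) <= C0) -> (forall i, (i < N)%nat -> Rabs (v i) <= C0) ->
  (forall k, INR (S k) / ta k <= eps) ->
  solvable a b 0 (4 * (C0 * (C0 * INR N * eps)) / al (N - 1)%nat).
Proof.
  intros Mod F Hu Hv He.
  assert (HN := mod_period _ _ _ _ _ _ Mod). assert (Hal := mod_al _ _ _ _ _ _ Mod).
  assert (Ht := mod_ta _ _ _ _ _ _ Mod).
  assert (HC : 0 <= C0) by (eapply Rle_trans; [apply Rabs_pos | apply (Hu O HN)]).
  assert (He0 : 0 <= eps).
  { eapply Rle_trans; [|apply (He O)]. apply Rmult_le_pos; [apply pos_INR|].
    left. apply Rinv_0_lt_compat, Ht. }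
  assert (Z := floquet_zero_energy_pair N al be gamma u v ta a b Mod F).
  destruct F as [Hg _ _ _ _ _ _ _ _ _ _].
  apply (green_solvable a b _ _ _ _ _ Z (Hal _)).
  - apply Rmult_le_pos; [|exact He0]. apply Rmult_le_pos; [exact HC | apply pos_INR].
  - intros n. eapply Rle_trans; [apply blocks_bound; [exact HN | exact Hu]|].
    rewrite gamma_pow_abs by exact Hg. lra.
  - intros n. eapply Rle_trans; [apply blocks_bound; [exact HN | exact Hv]|].
    set (k := (n / N)%nat). unfold Rdiv.
    rewrite Rabs_mult, gamma_pow_abs, Rmult_1_l, !Rmult_assoc by exact Hg.
    assert (Htk := Ht k). specialize (He k).
    rewrite Rabs_pos_eq by (left; apply Rinv_0_lt_compat, Htk).
    apply Rmult_le_compat_l; [exact HC|].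
    assert (Hn : INR (S n) <= INR N * INR (S k)).
    { rewrite <- mult_INR. apply le_INR. unfold k.
      assert (D := Nat.div_mod_eq n N). assert (U := Nat.mod_upper_bound n N ltac:(lia)). nia. }
    assert (Hpos : 0 < INR (S n)) by (apply lt_0_INR; lia).
    assert (Hkpos : 0 < INR (S k)) by (apply lt_0_INR; lia).
    apply Rmult_le_reg_r with (INR (S n)); [exact Hpos|].
    apply Rle_trans with (INR N * (INR (S k) / ta k)).
    + unfold Rdiv. rewrite <- Rmult_assoc, (Rmult_comm (/ ta k)).
      apply Rmult_le_compat_r; [left; apply Rinv_0_lt_compat, Htk | exact Hn].
    + replace (INR N * (eps * / INR (S n)) * INR (S n)) with (INR N * eps) by (field; lra).
      apply Rmult_le_compat_l; [apply pos_INR | exact He].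
Qed.

(** * Spectrum of the modulated operator *)

(** A null vector is a multiple of [p], whose modulus is 1 at all multiples of [N];
    a nonzero multiple is therefore not square-summable. *)
Lemma floquet_injective N al be gamma u v ta a b :
  modulated N al be ta a b -> floquet_pair N al be gamma u v ->
  injective_on_l2 a b 0.
Proof.
  intros Mod F x Hx E.
  assert (HN := mod_period _ _ _ _ _ _ Mod). assert (Ha := modulated_pos _ _ _ _ _ _ Mod).
  destruct (floquet_zero_energy_pair N al be gamma u v ta a b Mod F) as [p0 Hp _ _ _].
  set (p := blocks N (fun k => gamma ^ k) u) in *.
  assert (Ex : forall n, x n = (x O * p n)%C).
  { intros n. apply Ceq_minus.
    replace (x n - x O * p n)%C with (x n + (- x O) * p n)%C by ring.
    apply (solution_zero_of_first_zero a b 0 (fun n => x n + (- x O) * p n)%C Ha).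
    - intros m. rewrite jacobi_plus_scal, E, Hp. ring.
    - rewrite p0. ring. }
  assert (X0 : x O = 0%C).
  { apply NNPP. intros F0. apply Cmod_gt_0 in F0.
    assert (B := l2_ball_l2norm x Hx). set (r := l2norm x) in *.
    assert (Low : forall K, INR (S K) * Cmod (x O) ^ 2 <= r ^ 2).
    { intros K. apply Rle_trans with (sum_n (fun k => Cmod (x (k * N)%nat) ^ 2) K).
      - right. rewrite <- (sum_n_const K (Cmod (x O) ^ 2)). apply sum_n_ext.
        intros k. rewrite (Ex (k * N)%nat), Cmod_mult.
        replace (k * N)%nat with (k * N + 0)%nat by lia. unfold p.
        rewrite blocks_at, (fp_u0 _ _ _ _ _ _ F), Rmult_1_r, Cmod_R, gamma_pow_abs, Rmult_1_r
          by (try exact HN; apply F).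
        reflexivity.
      - eapply Rle_trans;
          [apply (sumR_multiples (fun n => Cmod (x n) ^ 2)); [exact HN | intros; apply pow2_ge_0]|].
        apply B. }
    destruct (nfloor_ex (r ^ 2 / Cmod (x O) ^ 2)) as [K [_ HK]].
    { apply Rmult_le_pos; [apply pow2_ge_0 | left; apply Rinv_0_lt_compat, pow_lt, F0]. }
    specialize (Low K). rewrite S_INR in Low.
    assert (P2 : 0 < Cmod (x O) ^ 2) by (apply pow_lt, F0).
    apply (Rmult_lt_compat_r (Cmod (x O) ^ 2)) in HK; [|exact P2].
    unfold Rdiv in HK. rewrite Rmult_assoc, Rinv_l in HK by lra. lra. }
  intros n. rewrite Ex, X0. ring.
Qed.

Lemma l2_ball_finite_support c K x :
  0 <= c -> (forall n, Cmod (x n) <= c) -> (forall n, (K <= n)%nat -> x n = 0%C) ->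
  l2_ball (c * sqrt (INR K)) x.
Proof.
  intros Hc Hx H0. split; [apply Rmult_le_pos; [exact Hc | apply sqrt_pos]|].
  rewrite Rpow_mult_distr, pow2_sqrt by apply pos_INR.
  assert (Sq : forall n, Cmod (x n) ^ 2 <= c ^ 2).
  { intros n. apply pow_incr. split; [apply Cmod_ge_0 | apply Hx]. }
  assert (Hc2 := pow2_ge_0 c).
  induction M as [|M IH].
  - rewrite sum_O. destruct K as [|K].
    + rewrite H0, Cmod_0 by lia. simpl. lra.
    + specialize (Sq O). rewrite S_INR. assert (0 <= INR K) by apply pos_INR. nra.
  - destruct (le_lt_dec K (S M)) as [L|L].
    + rewrite sumR_S, (H0 (S M) L), Cmod_0. lra.
    + eapply Rle_trans; [apply (sumR_const_le _ (c ^ 2)); intros; apply Sq|].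
      rewrite Rmult_comm. apply Rmult_le_compat_l; [exact Hc2 | apply le_INR; lia].
Qed.

Lemma resolvent_bound T z :
  in_resolvent_set T z ->
  exists M, 0 <= M /\ forall x r, dom T x ->
    l2_ball r (fun n => act T x n - z * x n)%C -> l2norm x <= M * r.
Proof.
  intros [G [M [H1 H2]]]. exists (Rabs M). split; [apply Rabs_pos|]. intros x r Hx B.
  destruct (H2 x Hx) as [_ E]. destruct (l2_ball_l2 _ _ B) as [Hy Ny].
  destruct (H1 _ Hy) as [_ [_ N]].
  replace (G (fun m => act T x m - z * x m)%C) with x in N
    by (symmetry; apply functional_extensionality, E).
  eapply Rle_trans; [exact N|].
  apply Rle_trans with (Rabs M * l2norm (fun m => act T x m - z * x m)%C).
  - apply Rmult_le_compat_r; [apply l2norm_ge0 | apply Rle_abs].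
  - apply Rmult_le_compat_l; [apply Rabs_pos | exact Ny].
Qed.

(** Equal to [m] up to index [m], then decreasing with slope -1 to 0 at [2 m];
    the truncated subtraction of naturals gives 0 beyond. *)
Definition plateau (m k : nat) : R := INR (Nat.min m (2 * m - k)).

Lemma plateau_step m k :
  Rabs (plateau m (S k) - plateau m k) <= 1 /\
  ((k < m \/ 2 * m <= k)%nat -> plateau m (S k) - plateau m k = 0).
Proof.
  unfold plateau. split.
  - assert (H : Nat.min m (2 * m - k) = Nat.min m (2 * m - S k)
                \/ Nat.min m (2 * m - k) = S (Nat.min m (2 * m - S k))) by lia.
    destruct H as [-> | ->]; [|rewrite S_INR]; apply Rabs_le; lra.
  - intros H. replace (Nat.min m (2 * m - S k)) with (Nat.min m (2 * m - k)) by lia. ring.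
Qed.

(** The test vector is [p] cut off by [plateau m].  Its squared norm is at least
    [m^3].  Its image is supported on the last rows of the blocks between [m] and
    [2 m], where it is bounded by [kappa ta_k <= 2 kappa m / T] once
    [k / ta_k > T] for [k >= m]; so the squared norm of the image is at most of
    order [m^3 / T^2]. *)
Lemma zero_not_in_resolvent_set N al be gamma u v ta a b :
  modulated N al be ta a b -> floquet_pair N al be gamma u v ->
  is_lim_seq (fun k => INR k / ta k) p_infty ->
  ~ in_resolvent_set (jacobi_operator a b) 0.
Proof.
  intros Mod F Hlim Hres.
  assert (HN := mod_period _ _ _ _ _ _ Mod). assert (Ht := mod_ta _ _ _ _ _ _ Mod).
  assert (Hal := mod_al _ _ _ _ _ _ Mod (N - 1)%nat).
  destruct (resolvent_bound _ _ Hres) as [M [HM Bound]].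
  destruct F as [Hg Su u0 u1 uL uN _ _ _ _ _].
  set (kappa := al (N - 1)%nat) in *.
  (* With [r] below, [(M r)^2] is [m^3 (T - 1) / T^2], which is less than [m^3]. *)
  set (T := 1 + 8 * M ^ 2 * kappa ^ 2 * INR N).
  assert (HNR : 0 < INR N) by (apply lt_0_INR, HN).
  assert (HT : 1 <= T).
  { assert (0 <= M ^ 2 * kappa ^ 2 * INR N); [|unfold T; lra].
    apply Rmult_le_pos; [|lra]. apply Rmult_le_pos; apply pow2_ge_0. }
  apply is_lim_seq_spec in Hlim. destruct (Hlim T) as [m0 Hm0].
  set (m := S m0).
  assert (Hm : 0 < INR m) by (apply lt_0_INR; unfold m; lia).
  set (c := fun k => plateau m k * gamma ^ k).
  set (x := blocks N c u).
  assert (Cx : forall k, al (N - 1)%nat * u (N - 1)%nat * (ta k * c k)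
             + (be O * u O + al O * u 1%nat) * (ta (S k) * c (S k)) = 0).
  { intros k. rewrite u1, uL. ring. }
  assert (Rx := blocks_row N al be ta a b u c Mod Su Cx).
  destruct (bounded_on_prefix u N) as [C0 [HC0 HC]].
  assert (c0 : forall k, (2 * m <= k)%nat -> c k = 0).
  { intros k Hk. unfold c, plateau. replace (2 * m - k)%nat with O by lia.
    rewrite Nat.min_0_r. simpl. ring. }
  assert (Far : forall k i, (i < N)%nat -> (2 * m * N <= k * N + i)%nat -> (2 * m <= k)%nat).
  { intros k i Hi H. nia. }
  assert (Bx : l2_ball (C0 * INR m * sqrt (INR (2 * m * N))) x).
  { apply l2_ball_finite_support.
    - apply Rmult_le_pos; lra.
    - intros n. eapply Rle_trans; [apply blocks_bound; [exact HN | exact HC]|].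
      apply Rmult_le_compat_l; [exact HC0|]. unfold c.
      rewrite Rabs_mult, gamma_pow_abs, Rmult_1_r by exact Hg.
      unfold plateau. rewrite Rabs_pos_eq by apply pos_INR. apply le_INR. lia.
    - intros n Hn. destruct (block_index N n HN) as [k [i [Hi ->]]].
      unfold x. rewrite blocks_at by exact Hi. rewrite c0 by (apply (Far k i Hi Hn)).
      f_equal. ring. }
  set (r := 2 * INR m / T * kappa * sqrt (INR (2 * m * N))).
  assert (Small : forall k, Rabs (ta k * (plateau m (S k) - plateau m k)) <= 2 * INR m / T).
  { intros k. destruct (plateau_step m k) as [S1 S0]. assert (Htk := Ht k).
    assert (Pos : 0 <= 2 * INR m / T)
      by (apply Rmult_le_pos; [lra | left; apply Rinv_0_lt_compat; lra]).
    destruct (le_lt_dec m k) as [L1|L1]; [|rewrite S0, Rmult_0_r, Rabs_R0 by lia; exact Pos].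
    destruct (le_lt_dec (2 * m) k) as [L2|L2]; [rewrite S0, Rmult_0_r, Rabs_R0 by lia; exact Pos|].
    rewrite Rabs_mult, (Rabs_pos_eq (ta k)) by lra.
    assert (HkT : T < INR k / ta k) by (apply Hm0; unfold m in L1; lia).
    assert (Hk2 : INR k <= 2 * INR m).
    { replace (2 * INR m) with (INR (2 * m)) by (rewrite mult_INR; simpl; ring). apply le_INR. lia. }
    assert (Htk' : ta k <= 2 * INR m / T).
    { apply Rmult_le_reg_r with T; [lra|].
      replace (2 * INR m / T * T) with (2 * INR m) by (field; lra).
      apply (Rmult_lt_compat_r (ta k)) in HkT; [|exact Htk].
      replace (INR k / ta k * ta k) with (INR k) in HkT by (field; lra). lra. }
    assert (0 <= Rabs (plateau m (S k) - plateau m k)) by apply Rabs_pos. nra. }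
  assert (Br : l2_ball r (fun n => jacobi_matrix a b x n - 0 * x n)%C).
  { apply l2_ball_ext with (jacobi_matrix a b x); [intros; ring|].
    apply l2_ball_finite_support.
    - apply Rmult_le_pos; [|lra].
      apply Rmult_le_pos; [lra | left; apply Rinv_0_lt_compat; lra].
    - intros n. destruct (block_index N n HN) as [k [i [Hi ->]]].
      unfold x. rewrite Rx by exact Hi. rewrite u1, Rmult_0_l, u0, uN.
      specialize (Small k). assert (P := Rabs_pos (ta k * (plateau m (S k) - plateau m k))).
      rewrite Cmod_R. destruct (Nat.eqb_spec (S i) N) as [E|E].
      + replace i with (N - 1)%nat by lia. fold kappa.
        replace (_ + _) with (kappa * (gamma ^ (S k) * (ta k * (plateau m (S k) - plateau m k))))
          by (unfold c; simpl pow; destruct (Nat.eqb (k * N + (N - 1)) 0); ring).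
        rewrite Rabs_mult, (Rabs_mult (gamma ^ S k)), gamma_pow_abs, Rabs_pos_eq by (lra || exact Hg).
        nra.
      + replace (_ + _) with 0 by (destruct (Nat.eqb (k * N + i) 0); ring).
        rewrite Rabs_R0. nra.
    - intros n Hn. destruct (block_index N n HN) as [k [i [Hi ->]]].
      assert (Hk := Far k i Hi Hn).
      unfold x. rewrite Rx, !c0, u1 by (lia || exact Hi). f_equal.
      destruct (Nat.eqb (S i) N), (Nat.eqb (k * N + i) 0); ring. }
  assert (Hx := proj1 (l2_ball_l2 _ _ Bx)).
  assert (Dx : dom (jacobi_operator a b) x).
  { split; [exact Hx|]. apply (l2_ball_l2 r).
    apply l2_ball_ext with (2 := Br). intros; ring. }
  assert (Up := Bound x r Dx Br).
  assert (Low : INR m * INR m ^ 2 <= l2norm x ^ 2).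
  { apply Rle_trans with (sum_n (fun k => Cmod (x (k * N)%nat) ^ 2) m0).
    - right. transitivity (sum_n (fun _ => INR m ^ 2) m0 : R); [symmetry; apply sum_n_const|].
      apply sum_n_ext_loc.
      intros k Hk. replace (k * N)%nat with (k * N + 0)%nat by lia. unfold x.
      rewrite blocks_at, u0, Rmult_1_r, Cmod_R by exact HN. unfold c.
      rewrite Rabs_mult, gamma_pow_abs, Rmult_1_r by exact Hg. unfold plateau.
      rewrite Nat.min_l by (unfold m; lia). rewrite Rabs_pos_eq by apply pos_INR. reflexivity.
    - eapply Rle_trans;
        [apply (sumR_multiples (fun n => Cmod (x n) ^ 2)); [exact HN | intros; apply pow2_ge_0]|].
      apply (l2_ball_l2norm x Hx). }
  assert (Up2 : l2norm x ^ 2 <= (M * r) ^ 2) by (apply pow_incr; split; [apply l2norm_ge0 | exact Up]).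
  assert (Er : (M * r) ^ 2 = INR m * INR m ^ 2 * ((T - 1) / T ^ 2)).
  { unfold r. rewrite !Rpow_mult_distr, pow2_sqrt by apply pos_INR.
    rewrite !mult_INR. unfold T at 2. simpl (INR 2). field. lra. }
  assert (Lt : (T - 1) / T ^ 2 < 1).
  { apply Rmult_lt_reg_r with (T ^ 2); [nra|].
    replace ((T - 1) / T ^ 2 * T ^ 2) with (T - 1) by (field; lra). nra. }
  assert (0 < INR m * INR m ^ 2) by (apply Rmult_lt_0_compat; [|apply pow_lt]; exact Hm).
  nra.
Qed.

(** Deleting [l] blocks replaces [ta] by its shift, for which [(k + 1) / ta (l + k)]
    is uniformly small; then [z] is within the reach of the Neumann series around
    energy 0. *)
Lemma shifted_blocks_spectral_estimates N al be gamma u v ta a b z :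
  modulated N al be ta a b -> floquet_pair N al be gamma u v ->
  is_lim_seq (fun k => INR k / ta k) 0 ->
  exists L c, 0 <= c /\
    solvable (fun n => a (L + n)%nat) (fun n => b (L + n)%nat) z c /\
    coercive (fun n => a (L + n)%nat) (fun n => b (L + n)%nat) z c.
Proof.
  intros Mod F Hlim. destruct Mod as [HN Hal Ht Ea Eb].
  assert (HalN := Hal (N - 1)%nat).
  destruct (bounded_on_prefix u N) as [Cu [HCu Hu]].
  destruct (bounded_on_prefix v N) as [Cv [HCv Hv]].
  set (C0 := Cu + Cv).
  set (Q := 4 * (C0 * (C0 * INR N)) / al (N - 1)%nat).
  assert (HQ : 0 <= Q).
  { apply Rmult_le_pos; [|left; apply Rinv_0_lt_compat, HalN].
    assert (0 <= INR N) by apply pos_INR. assert (0 <= C0) by (unfold C0; lra).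
    assert (0 <= C0 * INR N) by (apply Rmult_le_pos; assumption). nra. }
  assert (Hz := Cmod_ge_0 z).
  set (eps := / (2 * ((Q + 1) * (Cmod z + 1)))).
  assert (Hden : 1 <= (Q + 1) * (Cmod z + 1)) by nra.
  assert (Heps : 0 < eps) by (apply Rinv_0_lt_compat; lra).
  apply is_lim_seq_spec in Hlim. destruct (Hlim (mkposreal eps Heps)) as [l0 Hl0]. simpl in Hl0.
  set (l := S l0).
  set (ta' := fun k => ta (l + k)%nat).
  set (a' := fun n => a (l * N + n)%nat). set (b' := fun n => b (l * N + n)%nat).
  assert (Mod' : modulated N al be ta' a' b').
  { constructor; [exact HN | exact Hal | intros k; apply Ht | |].
    - intros k i Hi. unfold a', ta'. rewrite <- Ea by exact Hi. f_equal. lia.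
    - intros k i Hi. unfold b', ta'. rewrite <- Eb by exact Hi. f_equal. lia. }
  assert (He' : forall k, INR (S k) / ta' k <= eps).
  { intros k. assert (H := Hl0 (l + k)%nat ltac:(unfold l; lia)). rewrite Rminus_0_r in H.
    apply Rle_trans with (INR (l + k) / ta (l + k)%nat).
    - apply Rmult_le_compat_r; [left; apply Rinv_0_lt_compat, Ht | apply le_INR; unfold l; lia].
    - eapply Rle_trans; [apply Rle_abs | lra]. }
  assert (S0 : solvable a' b' 0 (Q * eps)).
  { replace (Q * eps) with (4 * (C0 * (C0 * INR N * eps)) / al (N - 1)%nat)
      by (unfold Q; field; lra).
    apply (floquet_solvable N al be gamma u v C0 ta' a' b' eps Mod' F); [| | exact He'].
    - intros i Hi. specialize (Hu i Hi). unfold C0. lra.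
    - intros i Hi. specialize (Hv i Hi). unfold C0. lra. }
  assert (K0 : coercive a' b' 0 (Q * eps)).
  { apply coercive_of_solvable; [|exact S0].
    exact (floquet_injective N al be gamma u v ta' a' b' Mod' F). }
  assert (HQe : 0 <= Q * eps) by (apply Rmult_le_pos; lra).
  assert (Sm : Q * eps * Cmod z <= / 2).
  { apply Rle_trans with ((Q + 1) * (Cmod z + 1) * eps); [|unfold eps; right; field; nra].
    rewrite Rmult_assoc, (Rmult_comm eps), <- Rmult_assoc.
    apply Rmult_le_compat_r; [lra | nra]. }
  exists (l * N)%nat, (2 * (Q * eps)). split; [lra|]. split.
  - apply solvable_perturb; assumption.
  - apply coercive_perturb; assumption.
Qed.

Lemma floquet_nodal_solution N al be gamma u v ta a b C0 :
  modulated N al be ta a b -> floquet_pair N al be gamma u v ->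
  (forall i, (i < N)%nat -> Rabs (u i) <= C0) ->
  nodal_solution N a b (blocks N (fun k => gamma ^ k) u) C0.
Proof.
  intros Mod F HC. assert (HN := mod_period _ _ _ _ _ _ Mod).
  assert (Z := floquet_zero_energy_pair N al be gamma u v ta a b Mod F).
  destruct F as [Hg _ u0 _ uL _ _ _ _ _ _].
  constructor.
  - exact HN.
  - apply Z.
  - intros n. eapply Rle_trans; [apply blocks_bound; [exact HN | exact HC]|].
    rewrite gamma_pow_abs by exact Hg. lra.
  - intros k. rewrite blocks_at, uL by lia. f_equal. ring.
  - intros k. replace (k * N)%nat with (k * N + 0)%nat by lia.
    rewrite blocks_at, u0, Rmult_1_r, Cmod_R by exact HN. apply gamma_pow_abs, Hg.
Qed.

(** The bound on [k / ta_k] for [k >= 1] gives one on [(k + 1) / ta_k] for all [k],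
    at the price of a factor 2 and of the separate term at [k = 0]. *)
Lemma zero_not_in_essential_spectrum N al be gamma u v ta a b M :
  modulated N al be ta a b -> floquet_pair N al be gamma u v ->
  (forall k, (1 <= k)%nat -> Rabs (INR k / ta k) <= M) ->
  ~ in_essential_spectrum (jacobi_operator a b) 0.
Proof.
  intros Mod F HM [Sp _]. apply Sp.
  destruct (bounded_on_prefix u N) as [Cu [HCu Hu]].
  destruct (bounded_on_prefix v N) as [Cv [HCv Hv]].
  eapply in_resolvent_set_of_solvable.
  - exact (floquet_injective N al be gamma u v ta a b Mod F).
  - apply (floquet_solvable N al be gamma u v (Cu + Cv) ta a b (1 / ta O + 2 * M) Mod F).
    + intros i Hi. specialize (Hu i Hi). lra.
    + intros i Hi. specialize (Hv i Hi). lra.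
    + assert (Ht := mod_ta _ _ _ _ _ _ Mod).
      assert (HM0 : 0 <= M) by (eapply Rle_trans; [apply Rabs_pos | apply (HM 1%nat); lia]).
      assert (H0 : 0 < 1 / ta O) by (unfold Rdiv; rewrite Rmult_1_l; apply Rinv_0_lt_compat, Ht).
      intros [|k]; [simpl; lra|].
      apply Rle_trans with (2 * (INR (S k) / ta (S k))).
      * unfold Rdiv. rewrite <- Rmult_assoc.
        apply Rmult_le_compat_r; [left; apply Rinv_0_lt_compat, Ht|].
        rewrite !S_INR. assert (0 <= INR k) by apply pos_INR. lra.
      * assert (H := HM (S k) ltac:(lia)). assert (R := Rle_abs (INR (S k) / ta (S k))). lra.
Qed.

(** Solvability for the matrix without its first rows is carried back row by row,
    both to show that every spectral point is an eigenvalue and to isolate it. *)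
Lemma essential_spectrum_empty N al be gamma u v ta a b :
  modulated N al be ta a b -> floquet_pair N al be gamma u v ->
  is_lim_seq (fun k => INR k / ta k) 0 ->
  forall z, ~ in_essential_spectrum (jacobi_operator a b) z.
Proof.
  intros Mod F Hlim z [Sp ND]. assert (Ha := modulated_pos _ _ _ _ _ _ Mod).
  assert (SE : forall w, in_spectrum (jacobi_operator a b) w ->
                         is_eigenvalue (jacobi_operator a b) w).
  { intros w Sw. apply NNPP. intros NE. apply Sw.
    destruct (shifted_blocks_spectral_estimates N al be gamma u v ta a b w Mod F Hlim)
      as [L [c [Hc [Hs _]]]].
    assert (I := injective_of_not_eigenvalue a b w NE).
    destruct (solvable_of_tail_solvable a b w) as [c' Hc']; [| | exact I |].
    - apply (peel_rows (fun a b => tail_solvable a b w)) with L; [|exact Ha|].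
      + intros; apply tail_solvable_peel; assumption.
      + exact (tail_solvable_of_solvable _ _ _ _ Hc Hs).
    - apply (peel_rows (fun a b => has_weyl_solution a b w)) with L; [|exact Ha|].
      + intros; apply weyl_solution_peel; assumption.
      + exact (weyl_solution_of_solvable _ _ _ _ Hs).
    - exact (in_resolvent_set_of_solvable a b w c' I Hc'). }
  apply ND. assert (Ez := SE z Sp).
  split; [split; [exact Sp|] | split; [exact Ez | exact (jacobi_finite_multiplicity a b z Ha Ez)]].
  destruct (shifted_blocks_spectral_estimates N al be gamma u v ta a b z Mod F Hlim)
    as [L [c [Hc [_ K]]]].
  destruct (bounded_on_prefix u N) as [C0 [_ HC]].
  destruct (eigenvalue_isolated a b _ C0 N z Ha
              (floquet_nodal_solution N al be gamma u v ta a b C0 Mod F HC)) as [eps [He Iso]].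
  - apply (peel_rows (fun a b => coercive_up_to_first a b z)) with L; [|exact Ha|].
    + intros; apply coercive_up_to_first_peel; assumption.
    + exact (coercive_up_to_first_of_coercive _ _ _ _ Hc K).
  - exact Ez.
  - exists eps. split; [exact He|]. intros w Sw. apply Iso, SE, Sw.
Qed.

Theorem theoremB
  (N : nat) (N_pos : (0 < N)%nat)
  (alpha beta : Z -> R)
  (alpha_periodic : forall n : Z, alpha (n + Z.of_nat N)%Z = alpha n)
  (beta_periodic : forall n : Z, beta (n + Z.of_nat N)%Z = beta n)
  (alpha_pos : forall n : Z, 0 < alpha n)
  (ta : nat -> R)
  (ta_pos : forall k : nat, 0 < ta k)
  (product_scalar : exists gamma : R, Rabs gamma = 1 /\
     mat_prod (fun i => transfer_matrix alpha beta (Z.of_nat i)) N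
       = mat2 gamma 0 0 gamma)
  (a b : nat -> R)
  (a_def : forall k i : nat, (i < N)%nat ->
     a (k * N + i)%nat = alpha (Z.of_nat i) * ta k)
  (b_def : forall k i : nat, (i < N)%nat ->
     b (k * N + i)%nat = beta (Z.of_nat i) * ta k) :
  (is_lim_seq (fun k => INR k / ta k) p_infty ->
     in_essential_spectrum (jacobi_operator a b) 0) /\
  ((exists M : R, forall k : nat, (1 <= k)%nat -> Rabs (INR k / ta k) <= M) ->
     ~ in_essential_spectrum (jacobi_operator a b) 0) /\
  (is_lim_seq (fun k => INR k / ta k) 0 ->
     forall z : C, ~ in_essential_spectrum (jacobi_operator a b) z).
Proof.
  destruct product_scalar as [gamma [Hg HP]].
  destruct (floquet_pair_exists N alpha beta gamma N_pos alpha_periodic beta_periodic alpha_pos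
              Hg HP) as [u [v F]].
  assert (Mod : modulated N (fun i => alpha (Z.of_nat i)) (fun i => beta (Z.of_nat i)) ta a b).
  { constructor; [exact N_pos | intros; apply alpha_pos | exact ta_pos | exact a_def | exact b_def]. }
  split; [|split].
  - intros Hlim. split.
    + exact (zero_not_in_resolvent_set _ _ _ _ _ _ _ _ _ Mod F Hlim).
    + intros [_ [[x [[[Hx _] E] [n Hn]]] _]]. apply Hn.
      exact (floquet_injective _ _ _ _ _ _ _ _ _ Mod F x Hx E n).
  - intros [M HM]. exact (zero_not_in_essential_spectrum _ _ _ _ _ _ _ _ _ M Mod F HM).
  - exact (essential_spectrum_empty _ _ _ _ _ _ _ _ _ Mod F).
Qed.
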